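(* Let $\sigma$ be a Kubo–Ando operator mean with representing operator monotone function $f$, and let $\alpha:=f'(1)$, assumed to satisfy $0<\alpha<1$. Then for every pair of positive semidefinite $n\times n$ matrices $A,B$, $$\lim_{p\searrow0}(A^p\sigma B^p)^{1/p}=P_0\exp\{(1-\alpha)P_0(\log A)P_0+\alpha P_0(\log B)P_0\},$$ where $P_0:=s(A)\wedge s(B)$.
   Context: A Kubo–Ando operator mean $\sigma$ corresponds to an operator monotone function $f\ge0$ on $[0,\infty)$ (operator monotone on $(0,\infty)$) with $f(1)=1$, via $A\sigma B:=A^{1/2}f(A^{-1/2}BA^{-1/2})A^{1/2}$ for positive definite $A,B$, extended to positive semidefinite $A,B$ by $A\sigma B:=\lim_{\varepsilon\searrow0}(A+\varepsilon I)\sigma(B+\varepsilon I)$. For a positive semidefinite $A$, $s(A)$ denotes its support projection (the orthogonal projection onto its range), and $\log A$ is defined in the generalized sense: the logarithm of $A$ restricted to the range of $s(A)$ and zero on its orthogonal complement. $P\wedge Q$ is the orthogonal projection onto the intersection of the ranges of $P$ and $Q$. Here $A^p$ ($p>0$) is the usual power. *)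

(* Defs.v *)
From HB Require Import structures.
From mathcomp Require Import all_boot all_order all_algebra.
From mathcomp Require Import complex.
From mathcomp Require Import all_classical all_reals.
From mathcomp Require Import all_analysis.
Set Implicit Arguments. Unset Strict Implicit. Unset Printing Implicit Defensive.
Import Order.TTheory GRing.Theory Num.Theory.
Local Open Scope ring_scope.
Local Open Scope complex_scope.

Section MatrixDefs.
Variable R : realType.
Local Notation C := R[i].

Definition adjmx m n (A : 'M[C]_(m, n)) : 'M[C]_(n, m) := (map_mx (@conjc R) A)^T.

Definition hermitian n (A : 'M[C]_n) : Prop := adjmx A = A.

Definition unitarymx n (U : 'M[C]_n) : Prop := U *m adjmx U = 1%:M.

Definition psdmx n (A : 'M[C]_n) : Prop :=
  forall v : 'cV[C]_n, 0 <= (adjmx v *m A *m v) 0 0.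
Definition pdmx n (A : 'M[C]_n) : Prop :=
  forall v : 'cV[C]_n, v != 0 -> 0 < (adjmx v *m A *m v) 0 0.

Definition loewner n (A B : 'M[C]_n) : Prop := psdmx (B - A).

Definition spec_decomp n (A : 'M[C]_n) (Ud : 'M[C]_n * 'rV[R]_n) : Prop :=
  unitarymx Ud.1 /\
  A = Ud.1 *m diag_mx (\row_i ((Ud.2 0 i)%:C)) *m adjmx Ud.1.

(* functional calculus h(A) := U diag(h(d)) U^* for a (chosen) spectral
   decomposition of the Hermitian matrix A (independent of the choice) *)
Definition mxfun n (h : R -> R) (A : 'M[C]_n) : 'M[C]_n :=
  let Ud := xget (1%:M, 0) [set Ud | spec_decomp A Ud] in
  Ud.1 *m diag_mx (\row_i ((h (Ud.2 0 i))%:C)) *m adjmx Ud.1.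

(* real powers A^p (p > 0, or p arbitrary for positive definite A) *)
Definition mxpow n (A : 'M[C]_n) (p : R) : 'M[C]_n := mxfun (fun x => x `^ p) A.

Definition mxexp n (A : 'M[C]_n) : 'M[C]_n := mxfun (@expR R) A.

Definition mxlog n (A : 'M[C]_n) : 'M[C]_n :=
  mxfun (fun x => if x == 0 then 0 else ln x) A.

Definition orthproj n (P : 'M[C]_n) : Prop := hermitian P /\ P *m P = P.

(* support projection: orthogonal projection onto the range (column space) *)
Definition suppmx n (A : 'M[C]_n) : 'M[C]_n :=
  xget 0 [set P | orthproj P /\ (P^T :=: A^T)%MS].

Definition projmeet n (P Q : 'M[C]_n) : 'M[C]_n :=
  xget 0 [set S | orthproj S /\ (S^T :=: (P^T :&: Q^T))%MS].

Definition mx_cvg0r n (g : R -> 'M[C]_n) (L : 'M[C]_n) : Prop :=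
  forall e : R, 0 < e -> exists2 d : R, 0 < d &
    forall t : R, 0 < t -> t < d -> forall i j, `|g t i j - L i j| < e%:C.

Definition mx_lim0r n (g : R -> 'M[C]_n) : 'M[C]_n :=
  xget 0 [set L | mx_cvg0r g L].

Definition operator_monotone (f : R -> R) : Prop :=
  forall m (A B : 'M[C]_m), pdmx A -> pdmx B -> loewner A B ->
    loewner (mxfun f A) (mxfun f B).

Definition KA_function (f : R -> R) : Prop :=
  operator_monotone f /\ (forall x : R, 0 <= x -> 0 <= f x) /\ f 1 = 1.

Definition KA_mean_pd n (f : R -> R) (A B : 'M[C]_n) : 'M[C]_n :=
  let Ah := mxpow A (2^-1) in
  let Aih := mxpow A (- 2^-1) in
  Ah *m mxfun f (Aih *m B *m Aih) *m Ah.

Definition KA_mean n (f : R -> R) (A B : 'M[C]_n) : 'M[C]_n :=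
  mx_lim0r (fun eps => KA_mean_pd f (A + (eps%:C)%:M) (B + (eps%:C)%:M)).

End MatrixDefs.

(* Main.v *)
Require Import Defs.
From HB Require Import structures.
From mathcomp Require Import all_boot all_order all_algebra.
From mathcomp Require Import complex.
From mathcomp Require Import all_classical all_reals.
From mathcomp Require Import all_analysis.
From mathcomp Require Import ring lra.
Import Order.TTheory GRing.Theory Num.Theory.
Import numFieldNormedType.Exports.
Import Defs.
Set Implicit Arguments. Unset Strict Implicit. Unset Printing Implicit Defensive.
Local Open Scope classical_set_scope.
Local Open Scope ring_scope.
Local Open Scope complex_scope.
Local Arguments real_complex_def : simpl never.
Local Arguments conjc : simpl never.

(* An operator monotone f with f(1) = 1, f'(1) = alpha is squeezed between the
   weighted harmonic and arithmetic functions: applying monotonicity to a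
   rotated 2 x 2 diagonal matrix gives concavity, hence the tangent bound at 1,
   and x |-> 1 / f(1 / x) is again operator monotone.  With S = X + Y and
   T = S^(-1/2) X S^(-1/2) one has X sigma Y = S^(1/2) g(T) S^(1/2), where
   g(t) = t f((1 - t) / t); since g has limits everywhere on [0, 1], the mean of
   positive semidefinite matrices exists by continuity of the functional
   calculus, without joint monotonicity of the mean.

   For Z_p = A^p sigma B^p, K = (1 - alpha) log A + alpha log B and
   Q = (1 - alpha) s(A) + alpha s(B), the upper bound is
   Z_p <= Q + p K + O(p^2); the eigenvalue 1 of Q belongs to P0 and the others
   are at most r < 1.  The lower bound uses M^-1 >= 2 P0 - P0 M P0 with M the
   weighted sum of inverses.  Hence, in a common eigenbasis of P0 and P0 K P0,
   Z_p lies between diagonal matrices equal to 1 + p k_i + O(p^2) on P0 and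
   contained in [0, r'], r' < 1, off P0.  Inversion being antitone, the
   resolvents of (Z_p - 1) / p converge, and Z_p^(1/p) is a function of them. *)

(** Bounds on Z_p cannot simply be raised to the power 1 / p, since x^q is not operator monotone for
    q > 1, and log Z_p is out of reach, since Z_p may be singular. Dividing Z_p - 1 by p sends the
    spectrum off P0 to -oo, where the resolvent tends to 0 and so does the exponential; the two
    regimes thus become a single convergence statement. The gap between r and 1 pays for the
    off-diagonal blocks of K. These are of order p, too large for the O(p^2) error allowed on P0,
    but they can be traded for O(p^2) there and for a constant smaller than the gap on the
    complement. In the lower bound A^p and B^p need not be invertible; P0 lies below both supports,
    so a compression by P0 only sees pseudo-inverses. Eigenvectors cannot be chosen continuously, so
    every limit in the functional calculus is taken with arbitrary eigenbases at each parameter. *)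

Local Notation "A ^H" := (adjmx A) (at level 8, format "A ^H") : ring_scope.


(** * Adjoints, real diagonal matrices and the order given by quadratic forms *)

Section QuadraticForms.
Variable R : realType.
Local Notation C := R[i].

Lemma adjmxE m n (A : 'M[C]_(m, n)) i j : A^H i j = conjc (A j i).
Proof. by rewrite !mxE. Qed.

Lemma addmxE m n (A B : 'M[C]_(m, n)) i j : (A + B) i j = A i j + B i j.
Proof. by rewrite mxE. Qed.

Lemma scalemxE m n c (A : 'M[C]_(m, n)) i j : (c *: A) i j = c * A i j.
Proof. by rewrite mxE. Qed.

Lemma adjmxK m n (A : 'M[C]_(m, n)) : A^H^H = A.
Proof. by apply/matrixP => i j; rewrite !adjmxE conjcK. Qed.

Lemma adjmxM m n p (A : 'M[C]_(m, n)) (B : 'M[C]_(n, p)) :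
  (A *m B)^H = B^H *m A^H.
Proof. by rewrite /adjmx map_mxM trmx_mul. Qed.

Lemma adjmxD m n (A B : 'M[C]_(m, n)) : (A + B)^H = A^H + B^H.
Proof. by rewrite /adjmx map_mxD linearD. Qed.

Lemma adjmxN m n (A : 'M[C]_(m, n)) : (- A)^H = - A^H.
Proof. by rewrite /adjmx map_mxN linearN. Qed.

Lemma adjmxB m n (A B : 'M[C]_(m, n)) : (A - B)^H = A^H - B^H.
Proof. by rewrite adjmxD adjmxN. Qed.

Lemma conjcR (c : R) : conjc c%:C = c%:C.
Proof. exact: conjc_real. Qed.

Lemma ReR (c : R) : complex.Re c%:C = c. Proof. by []. Qed.
Lemma ImR (c : R) : complex.Im c%:C = 0. Proof. by []. Qed.

Lemma conjcM (x y : C) : conjc (x * y) = conjc x * conjc y.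
Proof. exact: (rmorphM (@conjc R)). Qed.

Lemma adjmxZ m n (c : R) (A : 'M[C]_(m, n)) : (c%:C *: A)^H = c%:C *: A^H.
Proof. by apply/matrixP => i j; rewrite !mxE conjcM conjcR. Qed.

Lemma adjmx1 n : (1%:M : 'M[C]_n)^H = 1%:M.
Proof. by rewrite /adjmx map_mx1 trmx1. Qed.

Lemma adjmx0 m n : (0 : 'M[C]_(m, n))^H = 0.
Proof. by rewrite /adjmx map_mx0 trmx0. Qed.

Definition dg n (d : 'I_n -> R) : 'M[C]_n := diag_mx (\row_i (d i)%:C).

Lemma dgE n (d : 'I_n -> R) i j : dg d i j = (d i *+ (i == j))%:C.
Proof. by rewrite !mxE; case: eqP => // _; rewrite rmorph0. Qed.

Lemma adjmx_dg n (d : 'I_n -> R) : (dg d)^H = dg d.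
Proof.
apply/matrixP => i j; rewrite adjmxE !dgE conjcR eq_sym.
by case: eqP => [->|].
Qed.

Lemma dgM n (d e : 'I_n -> R) : dg d *m dg e = dg (fun i => d i * e i).
Proof.
rewrite /dg mulmx_diag; congr diag_mx.
by apply/rowP => i; rewrite !mxE rmorphM.
Qed.

Lemma dgD n (d e : 'I_n -> R) : dg d + dg e = dg (fun i => d i + e i).
Proof. by apply/matrixP => i j; rewrite mxE !dgE mulrnDl rmorphD. Qed.

Lemma dgZ n (c : R) (d : 'I_n -> R) : c%:C *: dg d = dg (fun i => c * d i).
Proof. by apply/matrixP => i j; rewrite mxE !dgE -mulrnAr rmorphM. Qed.

Lemma dg1 n : dg (fun=> 1) = 1%:M :> 'M[C]_n.
Proof. by apply/matrixP => i j; rewrite dgE mxE; case: eqP. Qed.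

Lemma dg0 n : dg (fun=> 0) = 0 :> 'M[C]_n.
Proof. by apply/matrixP => i j; rewrite dgE mxE mul0rn. Qed.

Lemma mul_dgE n m (d : 'I_n -> R) (A : 'M[C]_(n, m)) i j :
  (dg d *m A) i j = (d i)%:C * A i j.
Proof. by rewrite mul_diag_mx !mxE. Qed.

Lemma mul_mx_dgE n m (d : 'I_n -> R) (A : 'M[C]_(m, n)) i j :
  (A *m dg d) i j = A i j * (d j)%:C.
Proof. by rewrite mul_mx_diag !mxE. Qed.

(** The real part makes the form real-valued for every matrix, so that linearity and comparisons
    carry no Hermitian side condition; for Hermitian matrices nothing is lost
    ([hermitian_qform_real]). *)
Definition rq n (M : 'M[C]_n) (v : 'cV[C]_n) : R :=
  complex.Re ((v^H *m M *m v) 0 0).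

Lemma rqD n (M N : 'M[C]_n) v : rq (M + N) v = rq M v + rq N v.
Proof. by rewrite /rq mulmxDr mulmxDl mxE raddfD. Qed.

Lemma rqN n (M : 'M[C]_n) v : rq (- M) v = - rq M v.
Proof. by rewrite /rq mulmxN mulNmx mxE raddfN. Qed.

Lemma rqB n (M N : 'M[C]_n) v : rq (M - N) v = rq M v - rq N v.
Proof. by rewrite rqD rqN. Qed.

Lemma rqZ n (c : R) (M : 'M[C]_n) v : rq (c%:C *: M) v = c * rq M v.
Proof.
rewrite /rq -scalemxAr -scalemxAl mxE.
by case: (_ 0 0) => a b /=; rewrite mul0r subr0.
Qed.

Lemma rq0 n v : rq (0 : 'M[C]_n) v = 0.
Proof. by rewrite /rq mulmx0 mul0mx mxE. Qed.

Lemma adjmx_form n (M : 'M[C]_n) (v : 'cV[C]_n) :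
  (v^H *m M *m v)^H = v^H *m M^H *m v.
Proof. by rewrite !adjmxM adjmxK mulmxA. Qed.

Lemma rq_conj n m (M : 'M[C]_n) (X : 'M[C]_(n, m)) v :
  rq (X^H *m M *m X) v = rq M (X *m v).
Proof. by rewrite /rq adjmxM !mulmxA. Qed.

Definition nsq (z : C) : R := complex.Re z ^+ 2 + complex.Im z ^+ 2.

Lemma nsq_ge0 z : 0 <= nsq z.
Proof. by rewrite addr_ge0 ?sqr_ge0. Qed.

Lemma nsqE z : (nsq z)%:C = conjc z * z.
Proof.
case: z => a b; rewrite /conjc /real_complex_def /nsq.
by apply/eqP; rewrite eq_complex /=; apply/andP; split; apply/eqP; ring.
Qed.

Lemma nsq_eq0 z : (nsq z == 0) = (z == 0).
Proof.
case: z => a b; rewrite /nsq /= paddr_eq0 ?sqr_ge0 // !sqrf_eq0.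
by rewrite eq_complex.
Qed.

Lemma rq_dg n (d : 'I_n -> R) v : rq (dg d) v = \sum_i d i * nsq (v i 0).
Proof.
rewrite /rq -mulmxA mxE raddf_sum; apply: eq_bigr => i _.
rewrite mul_dgE adjmxE mulrCA -nsqE -rmorphM /=.
by [].
Qed.

Lemma rq1_ge0 n (v : 'cV[C]_n) : 0 <= rq 1%:M v.
Proof.
by rewrite -dg1 rq_dg sumr_ge0 // => i _; rewrite mul1r nsq_ge0.
Qed.

Lemma rq1_eq0 n (v : 'cV[C]_n) : rq 1%:M v = 0 -> v = 0.
Proof.
rewrite -dg1 rq_dg => /eqP; rewrite psumr_eq0; last first.
  by move=> i _; rewrite mul1r nsq_ge0.
move=> /allP v0; apply/matrixP => i j; rewrite ord1 mxE; apply/eqP.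
by have := v0 i (mem_index_enum _); rewrite /= mul1r nsq_eq0.
Qed.

Lemma rq_gram_ge0 n m (X : 'M[C]_(m, n)) v : 0 <= rq (X^H *m X) v.
Proof. by rewrite -[X^H]mulmx1 rq_conj rq1_ge0. Qed.

Lemma rq_col n m (M : 'M[C]_n) (X : 'M[C]_(n, m)) j :
  rq M (col j X) = complex.Re ((X^H *m M *m X) j j).
Proof.
have adj_col : (col j X)^H = row j X^H by apply/matrixP => a b; rewrite !mxE.
rewrite /rq adj_col.
rewrite -row_mul mxE [in RHS]mxE; congr complex.Re.
by apply: eq_bigr => k _; rewrite [row _ _ _ _]mxE [col _ _ _ _]mxE.
Qed.

Definition qle n (M N : 'M[C]_n) := forall v, rq M v <= rq N v.

Lemma hermitian_qform_real n (A : 'M[C]_n) v : hermitian A ->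
  (v^H *m A *m v) 0 0 = (rq A v)%:C.
Proof.
move=> hA; rewrite /rq; have : (v^H *m A *m v)^H = v^H *m A *m v.
  by rewrite !adjmxM adjmxK hA mulmxA.
move=> /matrixP/(_ 0 0); rewrite adjmxE.
case: ((v^H *m A *m v) 0 0) => a b [] /eqP; rewrite -subr_eq0 -opprD oppr_eq0 -mulr2n.
by rewrite mulrn_eq0 /= => /eqP ->.
Qed.

Lemma qle_psd n (A : 'M[C]_n) : hermitian A -> qle 0 A -> psdmx A.
Proof.
move=> hA A0 v; rewrite hermitian_qform_real // ler0c.
by have := A0 v; rewrite rq0.
Qed.

Lemma psd_qle n (A : 'M[C]_n) : psdmx A -> qle 0 A.
Proof.
move=> A0 v; rewrite rq0; have := A0 v; rewrite lecE => /andP[_].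
by [].
Qed.

(** Being nonnegative in [C] includes being real, so the form of [A^H - A] vanishes at every vector.
    Polarization with the vectors e_i + e_j and e_i + i e_j then kills each entry. *)
Lemma psd_hermitian n (A : 'M[C]_n) : psdmx A -> hermitian A.
Proof.
move=> A0; rewrite /hermitian; apply/matrixP => i j.
pose F (v : 'cV[C]_n) := ((v^H *m (A^H - A) *m v) 0 0).
have F0 v : F v = 0.
  rewrite /F mulmxDr mulmxDl mulmxN mulNmx mxE [X in _ + X]mxE.
  rewrite -adjmx_form adjmxE.
  have := A0 v; rewrite lecE; case: ((v^H *m A *m v) 0 0) => a b /= /andP[/eqP -> _].
  by rewrite /conjc oppr0 subrr.
have Fe (c : C) : F (delta_mx i 0 + c *: delta_mx j 0) =
    (A^H - A) i i + c * (A^H - A) i j + conjc c * (A^H - A) j i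
    + conjc c * c * (A^H - A) j j.
  rewrite /F; move: (A^H - A) => M.
  have -> : (delta_mx i 0 + c *: delta_mx j 0)^H =
      delta_mx 0 i + conjc c *: delta_mx 0 j :> 'M[C]_(1, n).
    rewrite adjmxD /adjmx map_mxZ !map_delta_mx linearZ /=.
    by rewrite !trmx_delta.
  rewrite mulmxDl !mulmxDr !mulmxDl -?scalemxAl -?scalemxAr -?scalemxAl.
  have E k l : (delta_mx 0 k *m M *m delta_mx l 0 : 'M[C]_1) 0 0 = M k l.
    by rewrite -rowE -colE !mxE.
  by rewrite !(addmxE, scalemxE) !E; ring.
have D0 k : (A^H - A) k k = 0.
  have := F0 (delta_mx k 0); rewrite /F /adjmx map_delta_mx trmx_delta.
  by rewrite -rowE -colE !mxE.
move: (F0 (delta_mx i 0 + 1 *: delta_mx j 0)); rewrite Fe.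
move: (F0 (delta_mx i 0 + 'i%C *: delta_mx j 0)); rewrite Fe.
rewrite !D0 !(mulr0, addr0, add0r, mulr1, mul1r) conjc1 mul1r.
set x := (A^H - A) i j; set y := (A^H - A) j i.
have -> : conjc 'i%C = - 'i%C :> C by apply/eqP; rewrite /conjc eq_complex /= oppr0 !eqxx.
rewrite mulNr -mulrBr => /eqP; rewrite mulf_eq0 subr_eq0.
have /negbTE -> : 'i%C != 0 :> C by rewrite eq_complex /= oner_eq0 andbF.
move=> /= /eqP <- /eqP; rewrite -mulr2n mulrn_eq0 /= /x !mxE subr_eq0.
by move=> /eqP.
Qed.

Lemma qle_loewner n (A B : 'M[C]_n) : hermitian A -> hermitian B ->
  qle A B -> loewner A B.
Proof.
move=> hA hB AB; apply: qle_psd => [|v].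
  by rewrite /hermitian adjmxB hA hB.
by rewrite rq0 rqB subr_ge0.
Qed.

Lemma loewner_qle n (A B : 'M[C]_n) : loewner A B -> qle A B.
Proof. by move=> /psd_qle AB v; have := AB v; rewrite rq0 rqB subr_ge0. Qed.

Lemma qle_trans n (A B D : 'M[C]_n) : qle A B -> qle B D -> qle A D.
Proof. by move=> AB BD v; apply: le_trans (AB v) (BD v). Qed.

Lemma qle_conj n m (A B : 'M[C]_n) (X : 'M[C]_(n, m)) : qle A B ->
  qle (X^H *m A *m X) (X^H *m B *m X).
Proof. by move=> AB v; rewrite !rq_conj. Qed.

Lemma qle_dg n (d e : 'I_n -> R) : (forall i, d i <= e i) ->
  qle (dg d) (dg e).
Proof.
by move=> de v; rewrite !rq_dg ler_sum // => i _; rewrite ler_wpM2r ?nsq_ge0.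
Qed.

Lemma qle_diag n (A B : 'M[C]_n) i : qle A B ->
  complex.Re (A i i) <= complex.Re (B i i).
Proof.
move=> AB; have := AB (col i 1%:M).
by rewrite !rq_col adjmx1 !mul1mx !mulmx1.
Qed.

Lemma hermitian_dg n (d : 'I_n -> R) : hermitian (dg d).
Proof. exact: adjmx_dg. Qed.

Lemma hermitian_conj n m (A : 'M[C]_n) (X : 'M[C]_(n, m)) : hermitian A ->
  hermitian (X^H *m A *m X).
Proof. by move=> hA; rewrite /hermitian !adjmxM adjmxK hA mulmxA. Qed.

Lemma hermitian_conjr n m (A : 'M[C]_n) (X : 'M[C]_(m, n)) : hermitian A ->
  hermitian (X *m A *m X^H).
Proof. by move=> hA; rewrite /hermitian !adjmxM adjmxK hA mulmxA. Qed.

Lemma hermitianD n (A B : 'M[C]_n) : hermitian A -> hermitian B ->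
  hermitian (A + B).
Proof. by rewrite /hermitian adjmxD => -> ->. Qed.

Lemma hermitianB n (A B : 'M[C]_n) : hermitian A -> hermitian B ->
  hermitian (A - B).
Proof. by rewrite /hermitian adjmxB => -> ->. Qed.

Lemma hermitianZ n c (A : 'M[C]_n) : hermitian A -> hermitian (c%:C *: A).
Proof. by rewrite /hermitian adjmxZ => ->. Qed.

Lemma hermitian_diag_real n (A : 'M[C]_n) i : hermitian A ->
  A i i = (complex.Re (A i i))%:C.
Proof.
move=> /matrixP/(_ i i); rewrite adjmxE; case: (A i i) => a b [] /eqP.
rewrite -subr_eq0 -opprD oppr_eq0 -mulr2n.
by rewrite mulrn_eq0 /= => /eqP ->.
Qed.

(* Test vector e_i - t conj(G_ij) e_j with t = 1 / (1 + G_jj). *)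
Lemma psd_entry n (G : 'M[C]_n) i j : hermitian G -> qle 0 G ->
  nsq (G i j) <= complex.Re (G i i) * (complex.Re (G j j) + 1).
Proof.
move=> hG G0.
pose t : R := (complex.Re (G j j) + 1)^-1.
pose c : C := (- t)%:C * conjc (G i j).
have := G0 (delta_mx i 0 + c *: delta_mx j 0); rewrite rq0 /rq.
have -> : (delta_mx i 0 + c *: delta_mx j 0)^H =
    delta_mx 0 i + conjc c *: delta_mx 0 j :> 'M[C]_(1, n).
  rewrite adjmxD /adjmx map_mxZ !map_delta_mx linearZ /=.
  by rewrite !trmx_delta.
rewrite mulmxDl !mulmxDr !mulmxDl -?scalemxAl -?scalemxAr -?scalemxAl.
have E k l : (delta_mx 0 k *m G *m delta_mx l 0 : 'M[C]_1) 0 0 = G k l.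
  by rewrite -rowE -colE !mxE.
rewrite !(addmxE, scalemxE) !E.
have -> : G j i = conjc (G i j) by rewrite -adjmxE hG.
have Gj0 : 0 <= complex.Re (G j j) by have := qle_diag j G0; rewrite mxE.
rewrite (hermitian_diag_real i hG) (hermitian_diag_real j hG) /c /=.
have tE : t * (complex.Re (G j j) + 1) = 1.
  by rewrite mulVf // gt_eqF // ltr_pwDr.
have t0 : 0 < t by rewrite invr_gt0 ltr_pwDr.
rewrite /nsq; case: (G i j) => a b /= {E}.
move: (complex.Re (G i i)) (complex.Re (G j j)) tE Gj0 => x y {c} tE y0 H.
have {}H : 0 <= x - 2 * t * (a ^+ 2 + b ^+ 2) + t ^+ 2 * y * (a ^+ 2 + b ^+ 2).
  by apply: le_trans H _; rewrite le_eqVlt; apply/orP; left; apply/eqP; ring.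
have ty : t ^+ 2 * y = t - t ^+ 2.
  by rewrite -[X in X - _]mulr1 -tE; ring.
rewrite ty in H.
have {H} : t * (a ^+ 2 + b ^+ 2) <= x.
  have := addr_ge0 (sqr_ge0 a) (sqr_ge0 b).
  by move: H; have := sqr_ge0 t; nra.
move=> H; have -> : a ^+ 2 + b ^+ 2 = (y + 1) * (t * (a ^+ 2 + b ^+ 2)).
  by rewrite mulrA [_ * t]mulrC tE mul1r.
by rewrite [leRHS]mulrC ler_wpM2l // addr_ge0.
Qed.

End QuadraticForms.

(** * Spectral theorem, functional calculus and antitonicity of inversion *)

Section SpectralCalculus.
Variable R : realType.
Local Notation C := R[i].

Fact udu_key : unit. Proof. by []. Qed.

(* Locked, so that rewriting with mulmxA does not unfold it. *)
Definition udu n (U : 'M[C]_n) (d : 'I_n -> R) : 'M[C]_n :=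
  locked_with udu_key (U *m dg d *m U^H).

Lemma uduE n (U : 'M[C]_n) d : udu U d = U *m dg d *m U^H.
Proof. by rewrite /udu unlock. Qed.

Lemma unitarymxV n (U : 'M[C]_n) : unitarymx U -> U^H *m U = 1%:M.
Proof. exact: mulmx1C. Qed.

Lemma unitarymx_adj n (U : 'M[C]_n) : unitarymx U -> unitarymx U^H.
Proof. by rewrite /unitarymx adjmxK; apply: unitarymxV. Qed.

Lemma eq_udu n (U : 'M[C]_n) (d e : 'I_n -> R) : d =1 e -> udu U d = udu U e.
Proof. by move=> /funext ->. Qed.

Lemma hermitian_udu n (U : 'M[C]_n) d : hermitian (udu U d).
Proof. by rewrite uduE; exact/hermitian_conjr/hermitian_dg. Qed.

Lemma uduM n (U : 'M[C]_n) d e : unitarymx U ->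
  udu U d *m udu U e = udu U (fun i => d i * e i).
Proof.
move=> hU; rewrite !uduE !mulmxA -[_ *m U^H *m U]mulmxA unitarymxV // mulmx1.
by rewrite -[U *m _ *m dg _]mulmxA dgM.
Qed.

Lemma uduD n (U : 'M[C]_n) d e : udu U d + udu U e = udu U (fun i => d i + e i).
Proof. by rewrite !uduE -mulmxDl -mulmxDr dgD. Qed.

Lemma uduZ n (U : 'M[C]_n) c d : c%:C *: udu U d = udu U (fun i => c * d i).
Proof. by rewrite !uduE scalemxAl scalemxAr dgZ. Qed.

Lemma udu1 n (U : 'M[C]_n) : unitarymx U -> udu U (fun=> 1) = 1%:M.
Proof. by move=> hU; rewrite !uduE dg1 mulmx1. Qed.

Lemma udu0 n (U : 'M[C]_n) : udu U (fun=> 0) = 0.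
Proof. by rewrite !uduE dg0 mulmx0 mul0mx. Qed.

Lemma udu_conj n (U : 'M[C]_n) d : unitarymx U -> U^H *m udu U d *m U = dg d.
Proof.
move=> hU; rewrite !uduE !mulmxA unitarymxV // mul1mx -mulmxA unitarymxV //.
by rewrite mulmx1.
Qed.

Lemma qle_udu n (U : 'M[C]_n) (d e : 'I_n -> R) : (forall i, d i <= e i) ->
  qle (udu U d) (udu U e).
Proof. by move=> /(@qle_dg R) /(@qle_conj R _ _ _ _ U^H); rewrite adjmxK !uduE. Qed.

Lemma udu_eigen_ge n (U : 'M[C]_n) d c i : unitarymx U ->
  qle (c%:C *: 1%:M) (udu U d) -> c <= d i.
Proof.
move=> hU; rewrite -(udu1 hU) uduZ => /(@qle_conj R _ _ _ _ U).
rewrite !udu_conj // => /(@qle_diag R _ _ _ i).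
by rewrite !dgE eqxx !mulr1n mulr1.
Qed.

Lemma udu_eigen_le n (U : 'M[C]_n) d c i : unitarymx U ->
  qle (udu U d) (c%:C *: 1%:M) -> d i <= c.
Proof.
move=> hU; rewrite -(udu1 hU) uduZ => /(@qle_conj R _ _ _ _ U).
rewrite !udu_conj // => /(@qle_diag R _ _ _ i).
by rewrite !dgE eqxx !mulr1n mulr1.
Qed.

(** The result does not depend on the decomposition picked by [xget]: [W] intertwines the two
    diagonal matrices, so a nonzero entry [W i j] forces [d i = e' j], and [W] then intertwines
    their images under [h] as well. *)
Lemma mxfun_udu n (h : R -> R) (U : 'M[C]_n) d : unitarymx U ->
  mxfun h (udu U d) = udu U (h \o d).
Proof.
move=> hU; rewrite /mxfun.
set Ud := xget _ _; have : spec_decomp (udu U d) Ud.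
  apply: (@xgetPex _ _ [set Ud | spec_decomp (udu U d) Ud]).
  exists (U, \row_i d i); split=> //=; rewrite !uduE /dg.
  by congr (_ *m diag_mx _ *m _); apply/rowP => i; rewrite !mxE.
case: Ud => V e [/= hV E].
pose e' i := e 0 i.
have {}E : udu U d = udu V e'.
  by rewrite E uduE; congr (_ *m diag_mx _ *m _); apply/rowP => i; rewrite !mxE.
transitivity (udu V (h \o e')).
  by rewrite uduE; congr (_ *m diag_mx _ *m _); apply/rowP => i; rewrite !mxE.
pose W := U^H *m V.
have EW : dg d *m W = W *m dg e'.
  rewrite -(udu_conj d hU) /W E !uduE !mulmxA.
  rewrite -[_ *m U *m U^H]mulmxA hU mulmx1.
  by rewrite -[_ *m V^H *m V]mulmxA unitarymxV // mulmx1.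
have EhW : dg (h \o d) *m W = W *m dg (h \o e').
  apply/matrixP => i j; have /matrixP/(_ i j) := EW.
  rewrite !mul_dgE !mul_mx_dgE /= mulrC.
  have [->|W0] := eqVneq (W i j) 0; first by rewrite !(mul0r, mulr0).
  by move=> /(mulfI W0)/complexI ->; rewrite mulrC.
have VE : V = U *m W by rewrite /W mulmxA hU mul1mx.
rewrite uduE [RHS]uduE {1}VE -[U *m W *m _]mulmxA -EhW /W !mulmxA.
by rewrite -[_ *m V *m V^H]mulmxA hV mulmx1.
Qed.

Lemma hermitian_spectral n (A : 'M[C]_n) : hermitian A ->
  exists U d, unitarymx U /\ A = udu U d.
Proof.
move=> hA.
have cjE m p (M : 'M[C]_(m, p)) : map_mx Num.conj M^T = M^H.
  by apply/matrixP => i j; rewrite !mxE.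
have hs : A \is hermsymmx.
  by apply/is_hermitianmxP; rewrite expr0 scale1r cjE hA.
have /hermitian_normalmx/orthomx_spectralP E := hs.
have /unitarymxP hS := spectral_unitarymx A.
have hS' : unitarymx (spectralmx A) by rewrite /unitarymx -cjE.
exists (spectralmx A)^H, (fun i => complex.Re (spectral_diag A 0 i)).
split; first exact: unitarymx_adj.
rewrite {1}E !uduE adjmxK; congr (_ *m diag_mx _ *m _).
  rewrite invmx_unitary ?cjE //; exact: spectral_unitarymx.
apply/rowP => i; rewrite !mxE.
have /mxOverP/(_ 0 i) := hermitian_spectral_diag_real hs.
by move=> /RRe_real.
Qed.

Lemma psd_spectral n (A : 'M[C]_n) : psdmx A ->
  exists U d, [/\ unitarymx U, forall i, 0 <= d i & A = udu U d].
Proof.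
move=> hA; have [U [d [hU E]]] := hermitian_spectral (psd_hermitian hA).
exists U, d; split=> // i; apply: (@udu_eigen_ge _ U) => //.
by rewrite -E scale0r; apply: psd_qle.
Qed.

(* Complete the square: [(X - N')^H *m N *m (X - N')] is nonnegative. *)
Lemma qle_inverse n (N N' X : 'M[C]_n) : hermitian N' -> qle 0 N ->
  N *m N' = 1%:M -> qle (X + X^H - X^H *m N *m X) N'.
Proof.
move=> hN' N0 NN'; have N'N := mulmx1C NN'.
have := @qle_conj R _ _ _ _ (X - N') N0.
rewrite adjmxB hN' mulmx0 mul0mx.
rewrite mulmxDr !mulmxDl mulmxN !mulNmx !mulmxN -[N' *m N *m N']mulmxA NN'.
rewrite -[X^H *m N *m N']mulmxA NN' !mulmx1 N'N mul1mx => H v.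
have := H v; rewrite rq0 !rqD !rqN.
move: (rq _ v) (rq _ v) (rq _ v) (rq _ v) => p q r u; lra.
Qed.

(** No square root is needed: [qle_inverse] with [X = B'] gives 2 B' - B' A B' <= A', and
    conjugating A <= B by B' gives B' A B' <= B'. *)
Lemma qle_antitone_inverse n (A A' B B' : 'M[C]_n) :
  hermitian A' -> hermitian B' -> qle 0 A ->
  A *m A' = 1%:M -> B *m B' = 1%:M -> qle A B -> qle B' A'.
Proof.
move=> hA' hB' A0 AA' BB' AB v.
have := @qle_inverse _ _ _ B' hA' A0 AA' v.
have := @qle_conj R _ _ _ _ B' AB v.
rewrite hB' rqB rqD [X in _ <= X](_ : _ = rq B' v); first by lra.
by rewrite -mulmxA BB' mulmx1.
Qed.

Lemma udu_inverse n (U : 'M[C]_n) d : unitarymx U -> (forall i, 0 < d i) ->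
  udu U d *m udu U (fun i => (d i)^-1) = 1%:M.
Proof.
move=> hU d0; rewrite (uduM _ _ hU) -(udu1 hU); apply: eq_udu => i.
by rewrite divff // gt_eqF.
Qed.

Lemma qle_udu_ge0 n (U : 'M[C]_n) (d : 'I_n -> R) : (forall i, 0 < d i) ->
  qle 0 (udu U d).
Proof. by move=> d0; rewrite -(udu0 U); apply: qle_udu => i; exact: ltW. Qed.

Lemma qle_udu_inverse n (U V : 'M[C]_n) (d e : 'I_n -> R) :
  unitarymx U -> unitarymx V -> (forall i, 0 < d i) -> (forall i, 0 < e i) ->
  qle (udu U d) (udu V e) ->
  qle (udu V (fun i => (e i)^-1)) (udu U (fun i => (d i)^-1)).
Proof.
move=> hU hV d0 e0; apply: qle_antitone_inverse; try exact: hermitian_udu.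
- exact: qle_udu_ge0.
- exact: udu_inverse.
- exact: udu_inverse.
Qed.

End SpectralCalculus.

(** * Scalar consequences of operator monotonicity: concavity, ratio bound, tangent bound *)

Section OperatorMonotone.
Variable R : realType.
Local Notation C := R[i].

Lemma pdmx_qle n (A : 'M[C]_n) c : hermitian A -> 0 < c ->
  qle (c%:C *: 1%:M) A -> pdmx A.
Proof.
move=> hA c0 cA v v0; rewrite hermitian_qform_real // ltcR.
apply: lt_le_trans (cA v); rewrite rqZ mulr_gt0 // lt_neqAle rq1_ge0 andbT.
by apply: contraNneq v0 => /esym/rq1_eq0 ->.
Qed.

Lemma psd_pdmx n (A : 'M[C]_n) : pdmx A -> psdmx A.
Proof.
move=> hA v; have [->|/hA/ltW//] := eqVneq v 0.
by rewrite mulmx0 mxE.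
Qed.

Lemma min_pos n (d : 'I_n -> R) : (forall i, 0 < d i) ->
  exists2 c, 0 < c & forall i, c <= d i.
Proof.
move=> d0; exists (\big[Num.min/1]_i d i).
  by apply: lt_bigmin.
by move=> i; apply: bigmin_le_cond.
Qed.

Lemma qle_udu_pos n (U : 'M[C]_n) d : unitarymx U -> (forall i, 0 < d i) ->
  exists2 c, 0 < c & qle (c%:C *: 1%:M) (udu U d).
Proof.
move=> hU /min_pos[c c0 cd]; exists c => //.
by rewrite -(udu1 hU) uduZ; apply: qle_udu => i; rewrite mulr1.
Qed.

Lemma pdmx_udu n (U : 'M[C]_n) d : unitarymx U -> (forall i, 0 < d i) ->
  pdmx (udu U d).
Proof.
move=> hU /(qle_udu_pos hU)[c c0 h].
exact: (pdmx_qle (hermitian_udu _ _) c0 h).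
Qed.

Lemma pd_eigen_gt0 n (U : 'M[C]_n) d i : unitarymx U ->
  pdmx (udu U d) -> 0 < d i.
Proof.
move=> hU hA; pose v := U *m delta_mx i (0 : 'I_1).
have v0 : v != 0.
  apply/eqP => v0.
  have : U^H *m v = 0 by rewrite v0 mulmx0.
  rewrite mulmxA unitarymxV // mul1mx => /matrixP/(_ i 0).
  by rewrite !mxE !eqxx => /eqP; rewrite oner_eq0.
have := hA v v0.
have -> : v^H *m udu U d *m v =
    (delta_mx i 0)^H *m (U^H *m udu U d *m U) *m delta_mx i 0.
  by rewrite /v adjmxM !mulmxA.
rewrite udu_conj //.
have -> : (delta_mx i 0)^H = delta_mx 0 i :> 'M[C]_(1, n).
  by rewrite /adjmx map_delta_mx trmx_delta.
rewrite -rowE -colE 2!mxE dgE eqxx mulr1n.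
by rewrite ltcR.
Qed.

Lemma pd_spectral n (A : 'M[C]_n) : pdmx A ->
  exists U d, [/\ unitarymx U, forall i, 0 < d i & A = udu U d].
Proof.
move=> hA; have [U [d [hU E]]] := hermitian_spectral (psd_hermitian (psd_pdmx hA)).
by exists U, d; split=> // i; apply: (@pd_eigen_gt0 _ U) => //; rewrite -E.
Qed.

Lemma udu_realE n (w : 'M[R]_n) d i j :
  udu (\matrix_(i, j) (w i j)%:C) d i j = (\sum_k w i k * d k * w j k)%:C.
Proof.
rewrite !uduE mxE rmorph_sum; apply: eq_bigr => k _.
by rewrite mul_mx_dgE adjmxE !mxE conjcR !rmorphM.
Qed.

Lemma ord2P (i : 'I_2) : i = ord0 \/ i = lift ord0 ord0.
Proof.
by case: (unliftP ord0 i) => [j ->|->]; [right; rewrite (ord1 j)|left].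
Qed.

Variable f : R -> R.
Implicit Types x y a b t e al : R.
Hypothesis hf : operator_monotone f.

(* Monotonicity is applied to [V^* diag(a, b) V], [V] the rotation of cosine
   [Num.sqrt (1 - t)], and to a diagonal matrix that dominates it by a rank-one
   term. *)
Lemma operator_monotone_concave a b t e : 0 < a -> 0 < b -> 0 <= t -> t <= 1 ->
  0 < e -> (1 - t) * f a + t * f b <= f ((1 - t) * a + t * b + e).
Proof.
move=> a0 b0 t0 t1 e0.
pose c := Num.sqrt (1 - t); pose s := Num.sqrt t.
have cE : c * c = 1 - t by rewrite -expr2 sqr_sqrtr // subr_ge0.
have sE : s * s = t by rewrite -expr2 sqr_sqrtr.
pose w : 'M[R]_2 := \matrix_(i, j) if i == ord0 then if j == ord0 then c else s
                       else if j == ord0 then - s else c.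
pose W : 'M[C]_2 := \matrix_(i, j) (w i j)%:C.
pose d (i : 'I_2) := if i == ord0 then a else b.
have d0 i : 0 < d i by rewrite /d; case: ifP.
have hW : unitarymx W.
  rewrite /unitarymx.
  have <- : udu W (fun=> 1) = W *m W^H by rewrite !uduE dg1 mulmx1.
  apply/matrixP => i j; rewrite udu_realE mxE !big_ord_recl big_ord0 !mxE /=.
  have cs : c * c + s * s = 1 by rewrite cE sE subrK.
  case: (ord2P i) => ->; case: (ord2P j) => -> /=; rewrite -[RHS]/(_%:R).
  - by rewrite !mulr1 addr0 cs.
  - by rewrite !mulr1 addr0 mulrN mulrC addNr.
  - by rewrite !mulr1 addr0 mulNr mulrC addNr.
  - by rewrite !mulr1 addr0 mulNr mulrN opprK addrC cs.
pose eta := Num.sqrt e.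
have etaE : eta * eta = e by rewrite -expr2 sqr_sqrtr // ltW.
have eta0 : eta != 0 by rewrite gt_eqF // sqrtr_gt0.
pose be := c * s * (b - a).
(* The rotated matrix has off-diagonal entry [be], and the rank-one term contributes [- be], so the
   sum is diagonal. The slack [e = eta ^+ 2] sits in the first entry, the only one read off at the
   end; the second entry may be as large as this requires. *)
pose D (i : 'I_2) := if i == ord0 then (1 - t) * a + t * b + e
   else t * a + (1 - t) * b + (be / eta) ^+ 2.
pose X : 'M[C]_(1, 2) :=
   \matrix_(i, j) (if j == ord0 then eta else - (be / eta))%:C.
have ND : dg D = udu W d + X^H *m X.
  apply/matrixP => i j; rewrite addmxE udu_realE dgE !mxE big_ord1 adjmxE !mxE.
  rewrite conjcR -rmorphM -rmorphD; congr (_%:C).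
  rewrite !big_ord_recl big_ord0 !mxE /D /d /=.
  case: (ord2P i) => ->; case: (ord2P j) => -> /=.
  - by rewrite mulr1n etaE -cE -sE; ring.
  - by rewrite mulr0n /be; field.
  - by rewrite mulr0n /be; field.
  - by rewrite mulr1n -{1}sE -cE; ring.
have le_ND : qle (udu W d) (dg D).
  by rewrite ND => v; rewrite rqD lerDl rq_gram_ge0.
have hpd : pdmx (udu W d) by apply: pdmx_udu.
have D1 : dg D = udu 1%:M D by rewrite !uduE adjmx1 mul1mx mulmx1.
have h1 : unitarymx (1%:M : 'M[C]_2) by rewrite /unitarymx mul1mx adjmx1.
have hpD : pdmx (dg D).
  have [g g0 hg] := qle_udu_pos hW d0.
  exact: (pdmx_qle (hermitian_dg _) g0 (qle_trans hg le_ND)).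
have := hf hpd hpD (qle_loewner (hermitian_udu _ _) (hermitian_dg _) le_ND).
move=> /loewner_qle/(@qle_diag _ _ _ _ ord0).
rewrite D1 !mxfun_udu // !uduE mul1mx adjmx1 mulmx1 dgE eqxx mulr1n.
rewrite -(uduE W _) udu_realE !ReR !big_ord_recl big_ord0 !mxE /D /d /=.
by rewrite -cE -sE addr0 [c * _ * c]mulrAC [s * _ * s]mulrAC.
Qed.

Hypothesis f_ge0 : forall x, 0 < x -> 0 <= f x.

Lemma operator_monotone_le x y : 0 < x -> x <= y -> f x <= f y.
Proof.
move=> x0; rewrite le_eqVlt => /predU1P[->//|xy].
have := @operator_monotone_concave x x 0 (y - x) x0 x0 (lexx 0) ler01.
by rewrite subr_gt0 subr0 !mul0r !mul1r !addr0 addrC subrK; apply.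
Qed.

Lemma operator_monotone_div_le x y : 0 < x -> x <= y -> f y <= y / x * f x.
Proof.
move=> x0 xy; have y0 := lt_le_trans x0 xy.
have [fy0|fy0] := leP (f y) 0.
  by apply: le_trans fy0 _; rewrite mulr_ge0 ?f_ge0 // divr_ge0 ?ltW.
rewrite leNgt; apply/negP => H.
have {}H : f x / f y < x / y.
  move: H; rewrite ltr_pdivrMr // mulrAC ltr_pdivrMr // => H.
  by rewrite mulrAC ltr_pdivlMr // mulrC [x * _]mulrC.
(* With [t] strictly between the two ratios, [t * y] stays below [x], which leaves room both for a
   left end [a > 0] and for a slack equal to [a], while [t * f y] still exceeds [f x]. *)
pose t := (f x / f y + x / y) / 2.
have t1 : f x / f y < t by rewrite /t midf_lt.
have t2 : t < x / y by rewrite /t midf_lt.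
have t0 : 0 <= t by apply: le_trans (ltW t1); rewrite divr_ge0 ?f_ge0 // ltW.
have xy1 : x / y <= 1 by rewrite ler_pdivrMr // mul1r.
have ty : t * y < x by rewrite -ltr_pdivlMr.
pose a := (x - t * y) / 2.
have a0 : 0 < a by rewrite divr_gt0 // subr_gt0.
have t1' : t <= 1 by apply: le_trans (ltW t2) xy1.
have := @operator_monotone_concave a y t a a0 y0 t0 t1' a0.
have le_x : (1 - t) * a + t * y + a <= x.
  have : 0 <= t * a by rewrite mulr_ge0 // ltW.
  have : 2 * a = x - t * y by rewrite /a; field.
  by lra.
have arg0 : 0 < (1 - t) * a + t * y + a.
  apply: ltr_wpDl => //; apply: addr_ge0; apply: mulr_ge0 => //.
  - by rewrite subr_ge0.
  - exact: ltW.
  - exact: ltW.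
have := operator_monotone_le arg0 le_x.
have : f x < t * f y by rewrite -ltr_pdivrMr.
have : 0 <= (1 - t) * f a by rewrite mulr_ge0 ?subr_ge0 ?f_ge0.
by lra.
Qed.

Hypothesis f1 : f 1 = 1.

Lemma operator_monotone_gt0 x : 0 < x -> 0 < f x.
Proof.
move=> x0; have [x1|x1] := leP 1 x.
  by apply: lt_le_trans (operator_monotone_le ltr01 x1); rewrite f1.
have := operator_monotone_div_le x0 (ltW x1).
by rewrite f1 mul1r ler_pdivlMl // mulr1; apply: lt_le_trans.
Qed.

(** Concavity between 1 and [b] with weight [t] and slack [t ^+ 2]: the slack is of second order, so
    it disappears when the inequality is divided by [t] and compared with the derivative at 1. *)
Lemma operator_monotone_tangent al b : is_derive (1 : R) 1 f al -> 0 < b ->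
  f b <= 1 + al * (b - 1).
Proof.
move=> hder b0; rewrite leNgt; apply/negP => H.
pose de := f b - (1 + al * (b - 1)).
have de0 : 0 < de by rewrite subr_gt0.
have al0 : 0 < `|al| + 1 by rewrite ltr_wpDl.
have bb0 : 0 < `|b - 1| + 1 by rewrite ltr_wpDl.
pose eta := de / 2 / (`|b - 1| + 1).
have eta0 : 0 < eta by rewrite !divr_gt0.
have : h^-1 *: (f (h *: 1 + 1) - f 1) @[h --> 0^'] --> al.
  by have [hd <-] := hder; exact: hd.
move=> /cvgrPdist_lt/(_ _ eta0); rewrite near_withinE near_simpl.
move=> /nbhs_ballP[r /= r0 hr].
(* The first bound gives |h| <= t (|b - 1| + 1), the second puts [h] in the ball where the
   difference quotient is within [eta] of [al], the third keeps [al * t] below [de / 4]. As [eta]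
   costs [de / 2], the total stays below [de]. *)
pose t := Num.min (1 / 2) (Num.min (r / 2 / (`|b - 1| + 1)) (de / 4 / (`|al| + 1))).
have t0 : 0 < t by rewrite !lt_min !divr_gt0.
have t1 : t <= 1 / 2 by rewrite /t ge_min lexx.
have t2 : t <= r / 2 / (`|b - 1| + 1) by rewrite /t !ge_min lexx orbT.
have t3 : t <= de / 4 / (`|al| + 1) by rewrite /t !ge_min lexx !orbT.
pose h := t * (b - 1 + t).
have nh : `|h| <= t * (`|b - 1| + 1).
  rewrite /h normrM (gtr0_norm t0) ler_pM2l //.
  apply: le_trans (ler_normD _ _) _; rewrite lerD2l gtr0_norm //.
  by apply: le_trans t1 _; lra.
have fh : f (1 + h) - 1 <= al * h + eta * `|h|.
  have [->|h0] := eqVneq h 0; first by rewrite addr0 f1 !(normr0, mulr0, subrr, addr0).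
  have /hr/(_ h0) : ball 0 r h.
    rewrite /ball /= sub0r normrN; apply: le_lt_trans nh _.
    by move: t2; rewrite ler_pdivlMr //; lra.
  rewrite /= f1 /GRing.scale /= mulr1 [h + 1]addrC => /ltW.
  have {1}-> : al = h^-1 * (al * h) by rewrite mulrCA mulVf // mulr1.
  rewrite -mulrBr normrM normfV ler_pdivrMl ?normr_gt0 // distrC.
  move=> /(le_trans (ler_norm _)).
  by rewrite lerBlDl => /le_trans; apply; rewrite mulrC [_ * `|h|]mulrC [h * _]mulrC.
have := @operator_monotone_concave 1 b t (t ^+ 2) ltr01 b0 (ltW t0).
rewrite exprn_gt0 // f1 mulr1.
have -> : 1 - t + t * b + t ^+ 2 = 1 + h by rewrite /h; ring.
move=> /(_ _ isT); have t11 : t <= 1 by apply: le_trans t1 _; lra.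
move=> /(_ t11) H2.
have H3 : t * (f b - 1) <= t * (al * (b - 1 + t) + eta * (`|b - 1| + 1)).
  have : eta * `|h| <= eta * (t * (`|b - 1| + 1)) by rewrite ler_pM2l.
  by rewrite /h in fh *; lra.
rewrite ler_pM2l // /eta divfK ?gt_eqF // in H3.
have : al * t <= de / 4.
  apply: (@le_trans _ _ ((`|al| + 1) * t)); last by rewrite mulrC -ler_pdivlMr.
  by rewrite ler_pM2r // (le_trans (ler_norm _)) // lerDl.
by rewrite /de in H3 *; rewrite mulrDr in H3; move: H3 de0; rewrite /de; lra.
Qed.

End OperatorMonotone.

(** * Harmonic lower bound through the adjoint function *)

Section KuboAndoFunction.
Variable R : realType.
Local Notation C := R[i].
Variable f : R -> R.
Implicit Types x y a b t e al : R.
Hypothesis hf : operator_monotone f.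
Hypothesis f_ge0 : forall x, 0 < x -> 0 <= f x.
Hypothesis f1 : f 1 = 1.
Let f_gt0 := operator_monotone_gt0 hf f_ge0 f1.

(** Inversion reverses the order once before and once after [f]; strict positivity of [f] makes the
    second inversion legitimate. *)
Lemma operator_monotone_adjoint : operator_monotone (fun x => (f x^-1)^-1).
Proof.
move=> m A B hA hB /loewner_qle.
have [U [d [hU d0 ->]]] := pd_spectral hA.
have [V [e [hV e0 ->]]] := pd_spectral hB.
move=> AB.
have inv_pos (q : 'I_m -> R) : (forall i, 0 < q i) -> forall i, 0 < (q i)^-1.
  by move=> q0 i; rewrite invr_gt0.
have fpos (q : 'I_m -> R) : (forall i, 0 < q i) -> forall i, 0 < f (q i).
  by move=> q0 i; rewrite f_gt0.
have H1 := qle_udu_inverse hU hV d0 e0 AB.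
have := hf (pdmx_udu hV (inv_pos _ e0)) (pdmx_udu hU (inv_pos _ d0))
  (qle_loewner (hermitian_udu _ _) (hermitian_udu _ _) H1).
rewrite !(mxfun_udu _ _ hU) !(mxfun_udu _ _ hV) => /loewner_qle H2.
apply: qle_loewner; [exact: hermitian_udu..|].
exact: qle_udu_inverse hV hU (fpos _ (inv_pos _ e0)) (fpos _ (inv_pos _ d0)) H2.
Qed.

(** The two inversions change the sign of the derivative twice, so the adjoint function also has
    derivative [al] at 1. Its tangent bound at 1 / x, inverted, is the claim. *)
Lemma operator_monotone_harmonic al x : is_derive (1 : R) 1 f al -> 0 < x ->
  0 < al -> al < 1 -> ((1 - al) + al / x)^-1 <= f x.
Proof.
move=> hder x0 al0 al1.
have hd : is_derive (1 : R) 1 (fun x => (f x^-1)^-1) al.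
  have h1 : is_derive (1 : R) 1 (fun x : R => x^-1) (- 1).
    have := @is_deriveV R id 1 1 1 (oner_neq0 _) (is_derive_id _ _).
    by rewrite /= expr1n invr1 /GRing.scale /= mulr1.
  have hd' : is_derive ((1 : R)^-1) 1 f al by rewrite invr1.
  have := @is_derive1_comp R f (fun x : R => x^-1) 1 al (- 1) hd' h1.
  move=> h2.
  have f10 : (f \o (fun x : R => x^-1)) 1 != 0 by rewrite /= invr1 f1 oner_neq0.
  have := @is_deriveV R _ _ _ _ f10 h2.
  rewrite /= invr1 f1 expr1n invr1 /GRing.scale /= mulN1r mulrN1 opprK.
  by [].
have g1 : (f (1^-1))^-1 = 1 :> R by rewrite invr1 f1 invr1.
have := operator_monotone_tangent operator_monotone_adjoint g1 hd.
move=> /(_ x^-1).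
rewrite invr_gt0 invrK => /(_ x0) H.
rewrite -[f x]invrK lef_pV2 ?posrE ?invr_gt0 ?f_gt0 //; last first.
  by rewrite addr_gt0 ?subr_gt0 // divr_gt0.
by apply: le_trans H _; rewrite mulrBr mulr1; lra.
Qed.

End KuboAndoFunction.

(** * Mean of two positive definite matrices, diagonalized through their sum *)

Section MeanOfPositiveDefinite.
Variable R : realType.
Local Notation C := R[i].

Lemma udu_mull n (L U : 'M[C]_n) d : udu (L *m U) d = L *m udu U d *m L^H.
Proof. by rewrite !uduE adjmxM !mulmxA. Qed.

Lemma udu_mulr_dg n (U : 'M[C]_n) a d :
  udu (U *m dg a) d = udu U (fun i => a i * d i * a i).
Proof. by rewrite !uduE adjmxM adjmx_dg -!dgM !mulmxA. Qed.

Lemma pdmx_conj n (X J L : 'M[C]_n) : L *m J = 1%:M -> pdmx X ->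
  pdmx (J^H *m X *m J).
Proof.
move=> LJ hX v v0; rewrite !mulmxA -adjmxM -mulmxA; apply: hX.
by apply: contraNneq v0 => Jv; rewrite -[v]mul1mx -LJ -mulmxA Jv mulmx0.
Qed.

Lemma mxpow_udu n (U : 'M[C]_n) d p : unitarymx U ->
  mxpow (udu U d) p = udu U (fun i => d i `^ p).
Proof. by move=> hU; rewrite /mxpow mxfun_udu. Qed.

Lemma inverse_unique n (M M' N : 'M[C]_n) :
  M *m M' = 1%:M -> N *m M = 1%:M -> M' = N.
Proof. by move=> MM' NM; rewrite -[M']mul1mx -NM -mulmxA MM' mulmx1. Qed.

Lemma conj_inverse n (H J D D' : 'M[C]_n) : J *m H = 1%:M ->
  D' *m D = 1%:M -> (J *m D' *m J) *m (H *m D *m H) = 1%:M.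
Proof.
move=> JH DD; rewrite !mulmxA -[_ *m J *m H]mulmxA JH mulmx1.
by rewrite -[_ *m D' *m D]mulmxA DD mulmx1.
Qed.

Lemma conj_add_sub n (H A B : 'M[C]_n) :
  H *m (A + A - B) *m H = H *m A *m H + H *m A *m H - H *m B *m H.
Proof. by rewrite !mulmxDr !mulmxDl mulmxN mulNmx. Qed.

Lemma conj_cancel n (H J P : 'M[C]_n) : J *m H = 1%:M ->
  H *m (J *m P *m J) *m H = P.
Proof.
move=> JH; rewrite !mulmxA (mulmx1C JH) mul1mx -mulmxA JH mulmx1.
exact: erefl.
Qed.

Lemma conj_cancel2 n (H J P D : 'M[C]_n) : J *m H = 1%:M ->
  H *m (J *m P *m J *m D *m (J *m P *m J)) *m H = P *m (J *m D *m J) *m P.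
Proof.
move=> JH; rewrite !mulmxA (mulmx1C JH) mul1mx -[_ *m J *m H]mulmxA JH mulmx1.
exact: erefl.
Qed.

Lemma mxpow_half n (X : 'M[C]_n) : pdmx X -> exists Xh Xi : 'M[C]_n,
  [/\ mxpow X 2^-1 = Xh, mxpow X (- 2^-1) = Xi, Xi^H = Xi,
      Xh *m Xi = 1%:M & Xi *m X *m Xi = 1%:M].
Proof.
move=> /pd_spectral[U [x [hU x0 ->]]].
exists (udu U (fun i => x i `^ 2^-1)), (udu U (fun i => x i `^ (- 2^-1))).
split; [exact: mxpow_udu..| exact: hermitian_udu | |].
  rewrite (uduM _ _ hU) -(udu1 hU); apply: eq_udu => i.
  by rewrite powRN divff // gt_eqF // powR_gt0.
rewrite !(uduM _ _ hU) -(udu1 hU); apply: eq_udu => i.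
rewrite powRN powR12_sqrt ?ltW // mulrAC -invfM -expr2 sqr_sqrtr ?ltW //.
by rewrite mulVf // gt_eqF.
Qed.

(** When [t] is an eigenvalue of the compression of X by (X + Y)^(-1/2), the ratio (1 - t) / t is an
    eigenvalue of X^(-1/2) Y X^(-1/2). The factor [x] keeps the function bounded near 0, where the
    ratio diverges. *)
Definition perspective (f : R -> R) x := x * f ((1 - x) / x).

Implicit Types x al : R.

Variables (n : nat) (U V X Y : 'M[C]_n) (s tau : 'I_n -> R).
Hypotheses (hU : unitarymx U) (hV : unitarymx V) (s0 : forall i, 0 < s i).
Hypotheses (hX : pdmx X) (hY : pdmx Y) (XY : X + Y = udu U s).
Let H := udu U (fun i => Num.sqrt (s i)).
Let J := udu U (fun i => (Num.sqrt (s i))^-1).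
Hypothesis hT : J *m X *m J = udu V tau.

Let hH : H^H = H. Proof. exact: hermitian_udu. Qed.
Let hJ : J^H = J. Proof. exact: hermitian_udu. Qed.

Let sqs0 i : Num.sqrt (s i) != 0.
Proof. by rewrite gt_eqF // sqrtr_gt0. Qed.

Let HJ : H *m J = 1%:M.
Proof.
by rewrite (uduM _ _ hU) -(udu1 hU); apply: eq_udu => i; rewrite divff.
Qed.

Let JH : J *m H = 1%:M. Proof. exact: mulmx1C. Qed.

Let JSJ : J *m udu U s *m J = 1%:M.
Proof.
rewrite !(uduM _ _ hU) -(udu1 hU); apply: eq_udu => i.
rewrite mulrAC -invfM -expr2 sqr_sqrtr ?ltW // mulVf //.
by rewrite gt_eqF.
Qed.

Let JYJ : J *m Y *m J = udu V (fun i => 1 - tau i).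
Proof.
have -> : Y = udu U s - X by rewrite -XY addrAC subrr add0r.
rewrite mulmxDr mulmxDl mulmxN mulNmx hT JSJ -(udu1 hV).
have -> : - udu V tau = (-1)%:C *: udu V tau by rewrite rmorphN scaleN1r.
by rewrite uduZ uduD; apply: eq_udu => i; rewrite mulN1r.
Qed.

Let XE : X = H *m udu V tau *m H.
Proof. by rewrite -hT (conj_cancel _ JH). Qed.

Let YE : Y = H *m udu V (fun i => 1 - tau i) *m H.
Proof. by rewrite -JYJ (conj_cancel _ JH). Qed.

Lemma mean_eigen_gt0 i : 0 < tau i.
Proof.
apply: (pd_eigen_gt0 _ hV); rewrite -hT -{1}hJ.
exact: pdmx_conj HJ hX.
Qed.

Lemma mean_eigen_lt1 i : tau i < 1.
Proof.
rewrite -subr_gt0; apply: (pd_eigen_gt0 (d := fun i => 1 - tau i) i hV).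
rewrite -JYJ -{1}hJ; exact: pdmx_conj HJ hY.
Qed.

Let tau0 := mean_eigen_gt0.
Let tau1 := mean_eigen_lt1.

(** [G] is unitary because [Xi *m X *m Xi] is the identity, and it diagonalizes [Xi *m Y *m Xi] with
    eigenvalues (1 - tau) / tau. The functional calculus is therefore read off in the basis [G], and
    the outer square roots of X cancel. *)
Lemma KA_mean_pdE f :
  KA_mean_pd f X Y = H *m udu V (fun i => perspective f (tau i)) *m H.
Proof.
have [Xh [Xi [EXh EXi hXi XhXi XiXXi]]] := mxpow_half hX.
rewrite /KA_mean_pd {}EXh {}EXi.
pose G := Xi *m H *m V *m dg (fun i => Num.sqrt (tau i)).
have sqt i : Num.sqrt (tau i) * Num.sqrt (tau i) = tau i.
  by rewrite -expr2 sqr_sqrtr ?ltW.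
have GE d : udu G d = Xi *m (H *m udu V (fun i => tau i * d i) *m H) *m Xi.
  have sqd : (fun i => Num.sqrt (tau i) * d i * Num.sqrt (tau i)) =
      (fun i => tau i * d i) by apply/funext => i; rewrite mulrAC sqt.
  by rewrite /G udu_mulr_dg sqd udu_mull adjmxM hH hXi !mulmxA.
have hG : unitarymx G.
  have G1 : G *m G^H = udu G (fun=> 1) by rewrite uduE dg1 mulmx1.
  have tau1' : (fun i => tau i * 1) = tau by apply/funext => i; rewrite mulr1.
  by rewrite /unitarymx G1 GE tau1' -XE XiXXi.
have -> : Xi *m Y *m Xi = udu G (fun i => (1 - tau i) / tau i).
  have E1 : (fun i => tau i * ((1 - tau i) / tau i)) = (fun i => 1 - tau i).
    by apply/funext => i; rewrite mulrCA divff ?mulr1 // gt_eqF.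
  by rewrite GE E1 -YE.
rewrite (mxfun_udu _ _ hG) GE !mulmxA XhXi mul1mx -mulmxA (mulmx1C XhXi) mulmx1.
exact: erefl.
Qed.

Lemma KA_mean_pd_hermitian f : hermitian (KA_mean_pd f X Y).
Proof.
rewrite KA_mean_pdE -{1}hH; apply: hermitian_conj; exact: hermitian_udu.
Qed.

(** In the frame of [V] both sides are diagonal; the tangent bound at (1 - t) / t, multiplied by t,
    reads g(t) <= (1 - al) t + al (1 - t). *)
Lemma KA_mean_pd_arith f al : (forall x, 0 < x -> f x <= 1 + al * (x - 1)) ->
  qle (KA_mean_pd f X Y) ((1 - al)%:C *: X + al%:C *: Y).
Proof.
move=> ub; rewrite KA_mean_pdE XE YE scalemxAl scalemxAr.
rewrite [al%:C *: _]scalemxAl [al%:C *: _]scalemxAr -mulmxDl -mulmxDr.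
rewrite !uduZ uduD -{1 3}hH; apply: qle_conj; apply: qle_udu => i.
have t0 := tau0 i; have := tau1 i; rewrite -subr_gt0 => t1.
apply: le_trans (ler_wpM2l (ltW t0) (ub _ (divr_gt0 t1 t0))) _.
rewrite le_eqVlt; apply/orP; left; apply/eqP.
by field; rewrite gt_eqF.
Qed.

(** The scalar bound says that the mean dominates the inverse of M = (1 - al) X' + al Y', whose
    eigenvalues in the frame of [V] are [nu]. Replacing M^-1 by [qle_inverse] at [J *m P *m J]
    leaves an expression in M alone, and P M P can stay bounded when X and Y degenerate. *)
Lemma KA_mean_pd_harm f al X' Y' P : 0 < al -> al < 1 ->
  (forall x, 0 < x -> ((1 - al) + al / x)^-1 <= f x) ->
  X *m X' = 1%:M -> Y *m Y' = 1%:M -> hermitian P ->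
  qle (P + P - P *m ((1 - al)%:C *: X' + al%:C *: Y') *m P)
      (KA_mean_pd f X Y).
Proof.
move=> al0 al1 lb XX' YY' hP.
pose nu i := (1 - al) / tau i + al / (1 - tau i).
have t1 i : 0 < 1 - tau i by rewrite subr_gt0.
have nu0 i : 0 < nu i by rewrite addr_gt0 // divr_gt0 // subr_gt0.
have inv (d : 'I_n -> R) M M' : (forall i, 0 < d i) ->
    M = H *m udu V d *m H -> M *m M' = 1%:M ->
    M' = J *m udu V (fun i => (d i)^-1) *m J.
  move=> d0 -> MM'; apply: inverse_unique MM' _.
  apply: (conj_inverse JH); rewrite (uduM _ _ hV) -(udu1 hV).
  by apply: eq_udu => i; rewrite mulVf // gt_eqF.
rewrite (inv _ _ _ tau0 XE XX') (inv _ _ _ t1 YE YY').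
rewrite scalemxAl scalemxAr [al%:C *: _]scalemxAl [al%:C *: _]scalemxAr.
rewrite -mulmxDl -mulmxDr !uduZ uduD -/nu.
have N0 : qle 0 (udu V nu).
  by rewrite -(udu0 V); apply: qle_udu => i; apply: ltW.
have NN' : udu V nu *m udu V (fun i => (nu i)^-1) = 1%:M.
  by rewrite (uduM _ _ hV) -(udu1 hV); apply: eq_udu => i; rewrite divff // gt_eqF.
have := @qle_conj _ _ _ _ _ H
  (qle_inverse (J *m P *m J) (hermitian_udu _ _) N0 NN').
have hJPJ : hermitian (J *m P *m J) by rewrite -{1}hJ; exact: hermitian_conj.
rewrite hJPJ hH conj_add_sub.
rewrite (conj_cancel _ JH) (conj_cancel2 _ _ JH).
move=> /qle_trans; apply.
rewrite KA_mean_pdE -{1 3}hH; apply: qle_conj; apply: qle_udu => i.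
have ti := tau0 i; have ui := t1 i.
apply: le_trans (ler_wpM2l (ltW ti) (lb _ (divr_gt0 ui ti))).
rewrite le_eqVlt; apply/orP; left; apply/eqP.
have -> : nu i = ((1 - al) + al / ((1 - tau i) / tau i)) / tau i.
  by rewrite /nu; field; rewrite !gt_eqF.
by rewrite invfM invrK mulrC.
Qed.

End MeanOfPositiveDefinite.

(** * Limits of matrices at 0+ and continuity of the functional calculus *)

Section MatrixLimits.
Variable R : realType.
Local Notation C := R[i].

Lemma oppmxE m n (A : 'M[C]_(m, n)) i j : (- A) i j = - A i j.
Proof. by rewrite mxE. Qed.

Lemma near0rP (P : R -> Prop) : (\forall t \near 0^'+, P t) <->
  exists2 d : R, 0 < d & forall t, 0 < t -> t < d -> P t.
Proof.
split.
  rewrite near_withinE => /nbhs_ballP[d /= d0 hd]; exists d => // t t0 td.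
  by apply: hd => //; rewrite /ball /= sub0r normrN gtr0_norm.
case=> d d0 hd; near=> t; apply: hd; near: t.
  exact: nbhs_right_gt.
exact: nbhs_right_lt.
Unshelve. all: by end_near. Qed.

Lemma normc_le (z : C) : `|z| <= (`|complex.Re z| + `|complex.Im z|)%:C.
Proof.
rewrite normc_def lecR.
have h : 0 <= `|complex.Re z| + `|complex.Im z| by rewrite addr_ge0.
rewrite -[leRHS](ger0_norm h) -sqrtr_sqr ler_wsqrtr // sqrrD !real_normK ?num_real //.
by rewrite lerD2r lerDl mulrn_wge0 // mulr_ge0.
Qed.

Lemma Re_norm_le (z : C) (e : R) : `|z| <= e%:C -> `|complex.Re z| <= e.
Proof. by rewrite -lecR; apply: le_trans; exact: normc_ge_Re. Qed.

Lemma Im_norm_le (z : C) (e : R) : `|z| <= e%:C -> `|complex.Im z| <= e.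
Proof.
move=> h; rewrite -lecR; apply: le_trans h; rewrite normc_def lecR.
by rewrite -sqrtr_sqr ler_wsqrtr // lerDr sqr_ge0.
Qed.

Lemma nsq_norm_le (z : C) (e : R) : 0 <= e -> nsq z <= e ^+ 2 -> `|z| <= e%:C.
Proof.
move=> e0 h; rewrite normc_def lecR -[leRHS]ger0_norm // -sqrtr_sqr.
exact: ler_wsqrtr.
Qed.

(** Splitting into real and imaginary parts gives access to the algebra of real limits; [ccvgP]
    returns to the modulus used by [mx_cvg0r]. *)
Definition ccvg (h : R -> C) (l : C) :=
  (complex.Re (h t) @[t --> 0^'+] --> complex.Re l) /\
  (complex.Im (h t) @[t --> 0^'+] --> complex.Im l).

Lemma ccvgP h l : ccvg h l <->
  forall e : R, 0 < e -> \forall t \near 0^'+, `|h t - l| < e%:C.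
Proof.
split=> [[hr hi] e e0|H].
  have e20 : 0 < e / 2 by rewrite divr_gt0.
  move/cvgrPdist_lt/(_ _ e20) : hr => hr.
  move/cvgrPdist_lt/(_ _ e20) : hi => hi.
  near=> t; apply: le_lt_trans (normc_le _) _; rewrite ltcR !raddfB /=.
  rewrite [e](splitr e) ltrD // distrC; near: t.
    exact: hr.
  exact: hi.
split; apply/cvgrPdist_le => e e0.
  near=> t; rewrite distrC -raddfB Re_norm_le // ltW //; near: t; exact: H.
near=> t; rewrite distrC -raddfB Im_norm_le // ltW //; near: t; exact: H.
Unshelve. all: by end_near. Qed.

Lemma ccvg_cst l : ccvg (fun=> l) l.
Proof. by split; apply: cvg_cst. Qed.

Lemma ccvgD h1 h2 l1 l2 : ccvg h1 l1 -> ccvg h2 l2 ->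
  ccvg (fun t => h1 t + h2 t) (l1 + l2).
Proof.
move=> [a1 b1] [a2 b2]; split; rewrite raddfD.
  by under eq_fun do rewrite raddfD; apply: cvgD.
by under eq_fun do rewrite raddfD; apply: cvgD.
Qed.

Lemma ccvgM h1 h2 l1 l2 : ccvg h1 l1 -> ccvg h2 l2 ->
  ccvg (fun t => h1 t * h2 t) (l1 * l2).
Proof.
move=> [a1 b1] [a2 b2].
have ReM (x y : C) : complex.Re (x * y) =
    complex.Re x * complex.Re y - complex.Im x * complex.Im y.
  by case: x y => [? ?] [? ?].
have ImM (x y : C) : complex.Im (x * y) =
    complex.Re x * complex.Im y + complex.Im x * complex.Re y.
  by case: x y => [? ?] [? ?].
split.
  rewrite ReM; under eq_fun do rewrite ReM.
  by apply: cvgB; apply: cvgM.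
rewrite ImM; under eq_fun do rewrite ImM.
by apply: cvgD; apply: cvgM.
Qed.

Lemma ccvg_sum n (h : 'I_n -> R -> C) l : (forall i, ccvg (h i) (l i)) ->
  ccvg (fun t => \sum_i h i t) (\sum_i l i).
Proof.
move=> H; elim: (index_enum _) => [|i r IH].
  rewrite big_nil; under eq_fun do rewrite big_nil; exact: ccvg_cst.
rewrite big_cons; under eq_fun do rewrite big_cons; exact: ccvgD.
Qed.

Lemma ccvg_real (h : R -> R) (l : R) : h t @[t --> 0^'+] --> l ->
  ccvg (fun t => (h t)%:C) l%:C.
Proof. by move=> hl; split=> //=; exact: cvg_cst. Qed.

Lemma mx_cvg0rP n (g : R -> 'M[C]_n) L : mx_cvg0r g L <->
  forall i j, ccvg (fun t => g t i j) (L i j).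
Proof.
split=> [H i j|H e e0].
  apply/ccvgP => e /H[d d0 hd]; apply/near0rP; exists d => // t t0 td.
  exact: hd.
apply/near0rP.
have K i j : \forall t \near 0^'+, `|g t i j - L i j| < e%:C.
  by have /ccvgP := H i j; apply.
have : \forall t \near 0^'+, forall ij : 'I_n * 'I_n,
    `|g t ij.1 ij.2 - L ij.1 ij.2| < e%:C.
  by apply: filter_forall => -[i j] /=.
by apply: filterS => t ht i j; exact: (ht (i, j)).
Qed.

Lemma mx_cvg0r_near n (g h : R -> 'M[C]_n) L :
  (\forall t \near 0^'+, g t = h t) -> mx_cvg0r g L -> mx_cvg0r h L.
Proof.
move=> gh H e /H/near0rP ge; apply/near0rP.
by apply: filterS2 gh ge => t ->.
Qed.

Lemma mx_cvg0r_unique n (g : R -> 'M[C]_n) L L' :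
  mx_cvg0r g L -> mx_cvg0r g L' -> L = L'.
Proof.
move=> /mx_cvg0rP H /mx_cvg0rP H'; apply/matrixP => i j.
have [a b] := H i j; have [a' b'] := H' i j.
apply/eqP; rewrite eq_complex.
by rewrite (cvg_unique _ a a') // (cvg_unique _ b b') // !eqxx.
Qed.

Lemma mx_lim0rE n (g : R -> 'M[C]_n) L : mx_cvg0r g L -> mx_lim0r g = L.
Proof.
move=> H; apply: (mx_cvg0r_unique (g := g)) => //.
by apply: (@xgetPex _ _ [set L | mx_cvg0r g L]); exists L.
Qed.

Lemma mx_cvg0r_cst n (L : 'M[C]_n) : mx_cvg0r (fun=> L) L.
Proof. by apply/mx_cvg0rP => i j; exact: ccvg_cst. Qed.

Lemma mx_cvg0rD n (g h : R -> 'M[C]_n) L K : mx_cvg0r g L -> mx_cvg0r h K ->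
  mx_cvg0r (fun t => g t + h t) (L + K).
Proof.
move=> /mx_cvg0rP gL /mx_cvg0rP hK; apply/mx_cvg0rP => i j.
by rewrite addmxE; under eq_fun do rewrite addmxE; exact: ccvgD.
Qed.

Lemma mx_cvg0rM n (g h : R -> 'M[C]_n) L K : mx_cvg0r g L -> mx_cvg0r h K ->
  mx_cvg0r (fun t => g t *m h t) (L *m K).
Proof.
move=> /mx_cvg0rP gL /mx_cvg0rP hK; apply/mx_cvg0rP => i j.
rewrite mxE; under eq_fun do rewrite mxE.
by apply: ccvg_sum => k; exact: ccvgM.
Qed.

Lemma mx_cvg0r_conj n (g : R -> 'M[C]_n) (L A B : 'M[C]_n) : mx_cvg0r g L ->
  mx_cvg0r (fun t => A *m g t *m B) (A *m L *m B).
Proof.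
move=> gL; apply: mx_cvg0rM (mx_cvg0r_cst _).
exact: mx_cvg0rM (mx_cvg0r_cst _) gL.
Qed.

Lemma mx_cvg0r_dg n (d : R -> 'I_n -> R) l :
  (forall i, d t i @[t --> 0^'+] --> l i) ->
  mx_cvg0r (fun t => dg (d t)) (dg l).
Proof.
move=> H; apply/mx_cvg0rP => i j.
rewrite dgE; under eq_fun do rewrite dgE.
apply: (@ccvg_real (fun t => d t i *+ (i == j)) (l i *+ (i == j))).
by case: (i == j); [exact: H|exact: cvg_cst].
Qed.

Lemma mx_cvg0r_udu n (U : 'M[C]_n) (d : R -> 'I_n -> R) l :
  (forall i, d t i @[t --> 0^'+] --> l i) ->
  mx_cvg0r (fun t => udu U (d t)) (udu U l).
Proof.
move=> H; rewrite uduE; under eq_fun do rewrite uduE.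
by apply: mx_cvg0r_conj; exact: mx_cvg0r_dg.
Qed.

Lemma rq_cvg n (g : R -> 'M[C]_n) L v : mx_cvg0r g L ->
  rq (g t) v @[t --> 0^'+] --> rq L v.
Proof.
move=> /mx_cvg0rP gL; rewrite /rq.
suff [] : ccvg (fun t => (v^H *m g t *m v) 0 0) ((v^H *m L *m v) 0 0) by [].
rewrite mxE; under eq_fun do rewrite mxE.
apply: ccvg_sum => j; apply: ccvgM; last exact: ccvg_cst.
rewrite mxE; under eq_fun do rewrite mxE.
by apply: ccvg_sum => k; apply: ccvgM; first exact: ccvg_cst.
Qed.

Lemma qle_cvg n (g h : R -> 'M[C]_n) L K : mx_cvg0r g L -> mx_cvg0r h K ->
  (\forall t \near 0^'+, qle (g t) (h t)) -> qle L K.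
Proof.
move=> gL hK gh v.
apply: (@ler_cvg_to R (0 : R)^'+ _ R _ _ _ _ (rq_cvg gL (v := v)) (rq_cvg hK (v := v))).
by apply: filterS gh => t; apply.
Qed.

Lemma unitarymx_col_sum n (W : 'M[C]_n) j : unitarymx W ->
  \sum_i nsq (W i j) = 1.
Proof.
move=> /unitarymxV/matrixP/(_ j j); rewrite !mxE eqxx mulr1n => H.
apply: complexI; rewrite rmorph_sum rmorph1 -H.
by apply: eq_bigr => i _; rewrite adjmxE; exact: nsqE.
Qed.

Lemma unitarymx_entry_le1 n (W : 'M[C]_n) i j : unitarymx W -> `|W i j| <= 1.
Proof.
move=> hW; rewrite -(rmorph1 (real_complex R)); apply: nsq_norm_le => //.
rewrite expr1n -(unitarymx_col_sum j hW) (bigD1 i) //= lerDl.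
by apply: sumr_ge0 => k _; exact: nsq_ge0.
Qed.

(** The entry (i, j) of (udu W rho - dg d) W is W_ij (rho_j - d_i). A matrix close to [dg d] thus
    has eigenvectors with small i-th coordinate unless their eigenvalue is near [d i]; this replaces
    continuity of eigenvectors. *)
Lemma eigenvector_entry n (W : 'M[C]_n) (rho d : 'I_n -> R) (eta : R) i j :
  unitarymx W -> (forall k, `|udu W rho i k - dg d i k| <= eta%:C) ->
  `|W i j| * `|rho j - d i|%:C <= (n%:R * eta)%:C.
Proof.
move=> hW H.
have E : W i j * (rho j - d i)%:C = \sum_k (udu W rho - dg d) i k * W k j.
  have : (udu W rho - dg d) *m W = W *m dg rho - dg d *m W.
    by rewrite mulmxDl mulNmx uduE -mulmxA unitarymxV // mulmx1.
  move=> /matrixP/(_ i j); rewrite [LHS]mxE => ->.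
  rewrite addmxE oppmxE mul_mx_dgE mul_dgE rmorphB mulrBr.
  by rewrite [(d i)%:C * _]mulrC.
have -> : `|rho j - d i|%:C = `|(rho j - d i)%:C|.
  by rewrite normc_def ReR ImR expr0n addr0 sqrtr_sqr.
rewrite -normrM E; apply: le_trans (ler_norm_sum _ _ _) _.
have -> : (n%:R * eta)%:C = \sum_(k < n) eta%:C.
  by rewrite sumr_const card_ord rmorphM rmorph_nat mulr_natl.
apply: ler_sum => k _; rewrite normrM -[leRHS]mulr1 ler_pM //.
  by have := H k; rewrite addmxE oppmxE.
exact: unitarymx_entry_le1.
Qed.

Section SpectralConvergence.
Variables (n : nat) (d b : 'I_n -> R) (M : R).
Variables (W : R -> 'M[C]_n) (rho c : R -> 'I_n -> R).
Hypothesis hW : \forall t \near 0^'+, unitarymx (W t).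
Hypothesis hc : \forall t \near 0^'+, forall j, `|c t j| <= M.
Hypothesis hb : forall i (e : R), 0 < e -> exists2 de : R, 0 < de &
  \forall t \near 0^'+, forall j, `|rho t j - d i| < de -> `|c t j - b i| < e.

(** The error in entry (i, k) is the sum over j of W_ij (c_j - b_i) conj(W_kj). In each term either
    [rho t j] is near [d i] and c_j - b_i is small, or W_ij is small and c_j - b_i is bounded. *)
Lemma spectral_cvg_dg : mx_cvg0r (fun t => udu (W t) (rho t)) (dg d) ->
  mx_cvg0r (fun t => udu (W t) (c t)) (dg b).
Proof.
move=> Hrho; apply/mx_cvg0rP => i k; apply/ccvgP => e e0.
pose e' := e / (n%:R + 1).
have n1 : 0 < n%:R + 1 :> R by rewrite ltr_wpDl // ler0n.
have e'0 : 0 < e' by rewrite divr_gt0.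
have [de de0 hde] := hb i e'0.
pose K := `|M| + `|b i| + 1.
have K0 : 0 < K by rewrite ltr_wpDl // addr_ge0.
(* This value makes n * eta / de * K at most [e'], the estimate for eigenvalues away from [d i].
   Dividing by n + 1 instead of n covers n = 0 and makes the final sum strictly smaller than [e]. *)
pose eta := e' * de / (n%:R + 1) / K.
have eta0 : 0 < eta by rewrite !(divr_gt0, mulr_gt0).
have Hn : \forall t \near 0^'+, forall k, `|udu (W t) (rho t) i k - dg d i k| <= eta%:C.
  have /near0rP := Hrho _ eta0.
  by apply: filterS => t ht l; exact/ltW/ht.
near=> t.
have ht : unitarymx (W t) by near: t.
have key j : `|W t i j| * `|c t j - b i|%:C <= e'%:C.
  have [lt_de|ge_de] := ltP `|rho t j - d i| de.
    rewrite -[leRHS]mul1r ler_pM //.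
    - by rewrite ler0c.
    - exact: unitarymx_entry_le1.
    - rewrite lecR ltW //; move: j lt_de; near: t; exact: hde.
  have hk : forall k, `|udu (W t) (rho t) i k - dg d i k| <= eta%:C by near: t.
  have W1 : `|W t i j| <= (n%:R * eta / de)%:C.
    have := eigenvector_entry j ht hk => H.
    have de0' : 0 < de%:C :> C by rewrite ltcR.
    rewrite rmorphM fmorphV -[X in _ * X]/((de%:C)^-1) ler_pdivlMr //.
    by apply: le_trans H; rewrite ler_wpM2l // lecR.
  have cb : `|c t j - b i| <= K.
    have : `|c t j| <= M by move: j {ge_de W1}; near: t.
    have := ler_normB (c t j) (b i); have := ler_norm M.
    by rewrite /K; lra.
  apply: (@le_trans _ _ ((n%:R * eta / de)%:C * K%:C)).
    by apply: ler_pM => //; [rewrite ler0c|rewrite lecR].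
  rewrite -rmorphM lecR.
  have -> : n%:R * eta / de * K = e' * (n%:R / (n%:R + 1)).
    by rewrite /eta; field; rewrite !gt_eqF.
  by rewrite ler_piMr ?ltW // ltr_pdivrMr // mul1r ltrDl.
have -> : udu (W t) (c t) i k - dg b i k =
    \sum_j W t i j * (c t j - b i)%:C * conjc (W t k j).
  have -> : dg b = dg b *m (W t *m (W t)^H) by rewrite ht mulmx1.
  rewrite mul_dgE uduE ![(_ *m (W t)^H) i k]mxE mulr_sumr -sumrB.
  apply: eq_bigr => j _; rewrite mul_mx_dgE adjmxE rmorphB.
  by rewrite mulrBr mulrBl mulrA [(b i)%:C * _]mulrC.
apply: le_lt_trans (ler_norm_sum _ _ _) _.
apply: (@le_lt_trans _ _ (\sum_(j < n) e'%:C)).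
  apply: ler_sum => j _; rewrite 2!normrM -[leRHS]mulr1 ler_pM //.
  - have -> : `|(c t j - b i)%:C| = `|c t j - b i|%:C.
      by rewrite normc_def ReR ImR expr0n addr0 sqrtr_sqr.
    exact: key.
  - by rewrite normcJ; exact: unitarymx_entry_le1.
rewrite sumr_const card_ord -mulr_natl -(rmorph_nat (real_complex R)) -rmorphM ltcR.
rewrite /e' mulrCA -[ltRHS]mulr1 ltr_pM2l // ltr_pdivrMr // mul1r ltrDl.
exact: ltr01.
Unshelve. all: by end_near. Qed.

End SpectralConvergence.

(* Continuity of the functional calculus, in a form that allows the function
   to vary along the limit and needs its continuity at the limit eigenvalues
   only. *)
Lemma spectral_cvg n (V : 'M[C]_n) (d b : 'I_n -> R) (M : R)
    (W : R -> 'M[C]_n) (rho c : R -> 'I_n -> R) : unitarymx V ->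
  (\forall t \near 0^'+, unitarymx (W t)) ->
  (\forall t \near 0^'+, forall j, `|c t j| <= M) ->
  (forall i (e : R), 0 < e -> exists2 de : R, 0 < de &
    \forall t \near 0^'+, forall j, `|rho t j - d i| < de -> `|c t j - b i| < e) ->
  mx_cvg0r (fun t => udu (W t) (rho t)) (udu V d) ->
  mx_cvg0r (fun t => udu (W t) (c t)) (udu V b).
Proof.
move=> hV hW hc hb H.
have hW' : \forall t \near 0^'+, unitarymx (V^H *m W t).
  apply: filterS hW => t ht; rewrite /unitarymx adjmxM adjmxK !mulmxA.
  by rewrite -[V^H *m W t *m _]mulmxA ht mulmx1 unitarymxV.
have E t r : udu (V^H *m W t) r = V^H *m udu (W t) r *m V.
  by rewrite udu_mull adjmxK.
have : mx_cvg0r (fun t => udu (V^H *m W t) (c t)) (dg b).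
  apply: (spectral_cvg_dg hW' hc hb).
  rewrite -(udu_conj d hV); under eq_fun do rewrite E.
  exact: mx_cvg0r_conj.
move=> /(@mx_cvg0r_conj _ _ _ V V^H); rewrite -uduE.
under eq_fun do rewrite E !mulmxA hV mul1mx -mulmxA hV mulmx1.
by [].
Qed.

End MatrixLimits.

(** * One-sided limits obtained from monotonicity *)

Section MonotoneLimits.
Variable R : realType.
Implicit Types (x y d e b : R) (u h : R -> R).

(** The point x = d is not excluded: at an interior point this is continuity with [b = h d], at 0
    and 1 it is a one-sided limit, and outside [0, 1] it is void. It matches the continuity
    hypothesis of [spectral_cvg]. *)
Definition unit_limit h d b := forall e, 0 < e -> exists2 de : R, 0 < de &
  forall x, 0 < x -> x < 1 -> `|x - d| < de -> `|h x - b| < e.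

Lemma nondecreasing_unit_limit0 u :
  (forall x y, 0 < x -> x <= y -> y < 1 -> u x <= u y) ->
  (forall x, 0 < x -> x < 1 -> 0 <= u x) ->
  exists2 b : R, 0 <= b & unit_limit u 0 b.
Proof.
move=> um u0; pose E := [set u x | x in [set x | 0 < x /\ x < 1]].
have h2 : 0 < (2^-1 : R) /\ (2^-1 : R) < 1 by split; lra.
have hE : has_inf E.
  split; first by exists (u 2^-1); exists 2^-1.
  by exists 0 => _ [x [x0 x1] <-]; exact: u0.
exists (inf E).
  apply: lb_le_inf; first exact: hE.1.
  by move=> _ [x [x0 x1] <-]; exact: u0.
move=> e e0; have [_ [y [y0 y1] <-] hy] := inf_adherent e0 hE.
exists y => // x x0 x1; rewrite subr0 gtr0_norm // => xy.
have lx : inf E <= u x by apply: ge_inf; [exact: hE.2|exists x].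
rewrite ger0_norm ?subr_ge0 // ltrBlDl; apply: le_lt_trans hy.
by apply: um => //; exact: ltW.
Qed.

(** Only h(x) / (1 - x) is monotone, with its infimum as limit at 0; multiplying back by 1 - x,
    which tends to 1, does not change the limit. *)
Lemma unit_limit0 h :
  (forall x y, 0 < x -> x <= y -> y < 1 -> h x / (1 - x) <= h y / (1 - y)) ->
  (forall x, 0 < x -> x < 1 -> 0 <= h x) ->
  exists b, unit_limit h 0 b.
Proof.
move=> hm h0.
have [x x0 x1|b b0 hb] := @nondecreasing_unit_limit0 (fun x => h x / (1 - x)) hm.
  by rewrite divr_ge0 ?h0 // subr_ge0 ltW.
exists b => e e0.
have m0 : 0 < Num.min (e / 2) 1 by rewrite lt_min ltr01 divr_gt0.
have [de de0 hde] := hb _ m0.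
exists (Num.min de (e / 2 / (b + 1))).
  by rewrite lt_min de0 !divr_gt0 // ltr_wpDl.
move=> x x0 x1; rewrite subr0 gtr0_norm // lt_min => /andP[xde xe].
have := hde x x0 x1; rewrite subr0 gtr0_norm // => /(_ xde).
rewrite lt_min => /andP[h1 h2].
have x10 : 0 < 1 - x by rewrite subr_gt0.
have hx : h x = (1 - x) * (h x / (1 - x)) by rewrite mulrC divfK // gt_eqF.
have u0 : 0 <= h x / (1 - x) by rewrite divr_ge0 ?h0 // ltW.
move: (h x / (1 - x)) u0 h1 h2 hx => v v0 h1 h2 ->.
have vb : v <= b + 1 by move: h2; rewrite ltr_norml => /andP[_]; lra.
have xv : x * v <= e / 2.
  apply: le_trans (ler_wpM2l (ltW x0) vb) _.
  by rewrite -ler_pdivlMr ?ltW // ltr_wpDl.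
have -> : (1 - x) * v - b = (v - b) - x * v by ring.
apply: le_lt_trans (ler_normB _ _) _.
rewrite [X in _ + X](_ : _ = x * v); first by lra.
by rewrite ger0_norm // mulr_ge0 // ltW.
Qed.

End MonotoneLimits.

(** * Limits of the perspective function on [0, 1] *)

Section Perspective.
Variable R : realType.
Variables (f : R -> R) (al : R).
Implicit Types x y d e b : R.
Hypothesis f_ge0 : forall x, 0 < x -> 0 <= f x.
Hypothesis f_le : forall x y, 0 < x -> x <= y -> f x <= f y.
Hypothesis f_div : forall x y, 0 < x -> x <= y -> f y <= y / x * f x.
Hypotheses (al0 : 0 < al) (al1 : al < 1).
Hypothesis f_ub : forall x, 0 < x -> f x <= 1 + al * (x - 1).
Local Notation g := (perspective f).

Let ratio_gt0 x : 0 < x -> x < 1 -> 0 < (1 - x) / x.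
Proof. by move=> x0 x1; rewrite divr_gt0 // subr_gt0. Qed.

Lemma perspective_ge0 x : 0 < x -> x < 1 -> 0 <= g x.
Proof.
by move=> x0 x1; rewrite mulr_ge0 ?(ltW x0) // f_ge0 // ratio_gt0.
Qed.

Lemma perspective_le1 x : 0 < x -> x < 1 -> g x <= 1.
Proof.
move=> x0 x1.
apply: le_trans (ler_wpM2l (ltW x0) (f_ub (ratio_gt0 x0 x1))) _.
have -> : x * (1 + al * ((1 - x) / x - 1)) = x + al * (1 - 2 * x).
  by field; rewrite gt_eqF.
have := ltW (mulr_gt0 al0 x0).
have : 0 <= (1 - al) * (1 - x) by rewrite mulr_ge0 ?subr_ge0 ?ltW.
by lra.
Qed.

Let ratio_le x y : 0 < x -> x <= y -> y < 1 -> (1 - y) / y <= (1 - x) / x.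
Proof.
move=> x0 xy y1; have y0 := lt_le_trans x0 xy.
rewrite ler_pdivrMr // mulrAC ler_pdivlMr //; nra.
Qed.

(** g(x) / x is [f] at the decreasing ratio (1 - x) / x. *)
Lemma perspective_lower x y : 0 < x -> x <= y -> y < 1 -> x / y * g y <= g x.
Proof.
move=> x0 xy y1; have y0 := lt_le_trans x0 xy.
have -> : x / y * g y = x * f ((1 - y) / y).
  by rewrite /perspective; field; rewrite gt_eqF.
apply: ler_wpM2l; first exact: ltW.
by apply: f_le; [exact: ratio_gt0|exact: ratio_le].
Qed.

(** g(x) / (1 - x) is f(u) / u at u = (1 - x) / x, and f(u) / u is nonincreasing by [f_div]. *)
Lemma perspective_upper x y : 0 < x -> x <= y -> y < 1 ->
  g x <= (1 - x) / (1 - y) * g y.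
Proof.
move=> x0 xy y1; have y0 := lt_le_trans x0 xy.
have := f_div (ratio_gt0 y0 y1) (ratio_le x0 xy y1).
move=> /(ler_wpM2l (ltW x0)) /le_trans; apply.
rewrite le_eqVlt; apply/orP; left; apply/eqP; rewrite /perspective.
by field; rewrite !gt_eqF // subr_gt0.
Qed.

(** The two ratio bounds, with 0 <= g(d) <= 1, give the local Lipschitz estimate |g(x) - g(d)| <= |x
    - d| / m, where [m] is the distance from [d] to the end points. *)
Let interior d : 0 < d -> d < 1 -> unit_limit g d (g d).
Proof.
move=> d0 d1 e e0; have d10 : 0 < 1 - d by rewrite subr_gt0.
pose m := Num.min d (1 - d).
have m0 : 0 < m by rewrite lt_min d0.
have [md md1] : m <= d /\ m <= 1 - d by rewrite /m !ge_min !lexx orbT.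
exists (e * m); first exact: mulr_gt0.
move=> x x0 x1 xd.
have gd0 := perspective_ge0 d0 d1; have gd1 := perspective_le1 d0 d1.
suff [h1 h2] : g x <= g d + `|x - d| / m /\ g d <= g x + `|x - d| / m.
  have : `|x - d| / m < e by rewrite ltr_pdivrMr.
  by rewrite ltr_norml; move: h1 h2; lra.
have bound a r : 0 <= a -> m <= r -> a / r * g d <= a / m.
  move=> a0 mr; have r0 := lt_le_trans m0 mr.
  rewrite -[leRHS]mulr1 ler_pM // ?divr_ge0 // ?(ltW r0) //.
  by rewrite ler_wpM2l // lef_pV2 ?posrE.
have [xd'|/ltW xd'] := leP x d.
  have a0 : 0 <= d - x by rewrite subr_ge0.
  have -> : `|x - d| = d - x by rewrite distrC ger0_norm.
  have := perspective_lower x0 xd' d1; have := perspective_upper x0 xd' d1.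
  have := bound _ _ a0 md; have := bound _ _ a0 md1.
  have -> : x / d = 1 - (d - x) / d by field; rewrite gt_eqF.
  have -> : (1 - x) / (1 - d) = 1 + (d - x) / (1 - d) by field; rewrite gt_eqF.
  by move=> *; split; lra.
have a0 : 0 <= x - d by rewrite subr_ge0.
have -> : `|x - d| = x - d by rewrite ger0_norm.
have x10 : 0 < 1 - x by rewrite subr_gt0.
have H1 : g x <= x / d * g d.
  have := perspective_lower d0 xd' x1.
  rewrite mulrAC ler_pdivrMr // => H.
  by rewrite mulrAC ler_pdivlMr // mulrC [x * _]mulrC.
have H2 : (1 - x) / (1 - d) * g d <= g x.
  have := perspective_upper d0 xd' x1.
  rewrite mulrAC ler_pdivlMr // => H.
  by rewrite mulrAC ler_pdivrMr // mulrC [g x * _]mulrC.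
have := bound _ _ a0 md; have := bound _ _ a0 md1.
move: H1 H2.
have -> : x / d = 1 + (x - d) / d by field; rewrite gt_eqF.
have -> : (1 - x) / (1 - d) = 1 - (x - d) / (1 - d) by field; rewrite gt_eqF.
by move=> *; split; lra.
Qed.

Lemma perspective_limit d : exists b, unit_limit g d b.
Proof.
have [d0|d0|->] := ltgtP d 0.
- exists 0 => e e0; exists (- d); first by rewrite oppr_gt0.
  by move=> x x0 x1; rewrite gtr0_norm ?subr_gt0 ?(lt_trans d0) //; lra.
- have [d1|d1|->] := ltgtP d 1.
  + by exists (g d); exact: interior.
  + exists 0 => e e0; exists (d - 1); first by rewrite subr_gt0.
    by move=> x x0 x1; rewrite ltr0_norm ?subr_lt0 ?(lt_trans x1) //; lra.
  (* Under the reflection x -> 1 - x, [perspective_lower] becomes the monotonicity required by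
     [unit_limit0]. *)
  + have [x y x0 xy y1|x x0 x1|b hb] := @unit_limit0 R (fun x => g (1 - x)).
    * have y0 := lt_le_trans x0 xy.
      have y10 : 0 < 1 - y by rewrite subr_gt0.
      have x10 : 0 < 1 - x by rewrite subr_gt0 (le_lt_trans xy).
      have := @perspective_lower (1 - y) (1 - x) y10.
      rewrite lerD2l lerN2 ltrBlDr ltrDl => /(_ xy x0).
      by rewrite mulrAC -mulrA mulrC -ler_pdivlMr.
    * by rewrite perspective_ge0 ?subr_gt0 // ltrBlDr ltrDl.
    exists b => e e0; have [de de0 hde] := hb e e0.
    exists de => // x x0 x1 hx.
    have := hde (1 - x); rewrite subKr subr_gt0 ltrBlDr ltrDl subr0.
    by rewrite distrC; apply.
- apply: unit_limit0 => [x y x0 xy y1|x x0 x1]; last exact: perspective_ge0.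
  rewrite ler_pdivrMr ?subr_gt0 ?(le_lt_trans xy) //.
  by rewrite mulrAC mulrC mulrA mulrAC [_ * (1 - x)]mulrC; exact: perspective_upper.
Qed.

End Perspective.

(** * Existence of the mean of positive semidefinite matrices *)

Section MeanOfPositiveSemidefinite.
Variable R : realType.
Local Notation C := R[i].

Lemma ccvg_conj (h : R -> C) l : ccvg h l -> ccvg (fun t => conjc (h t)) (conjc l).
Proof.
move=> [a b].
have ReJ (z : C) : complex.Re (conjc z) = complex.Re z by case: z.
have ImJ (z : C) : complex.Im (conjc z) = - complex.Im z by case: z.
split; first by rewrite ReJ; under eq_fun do rewrite ReJ.
by rewrite ImJ; under eq_fun do rewrite ImJ; exact: cvgN.
Qed.

Lemma hermitian_cvg n (g : R -> 'M[C]_n) L : mx_cvg0r g L ->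
  (\forall t \near 0^'+, hermitian (g t)) -> hermitian L.
Proof.
move=> gL gh; apply: (mx_cvg0r_unique (g := g)) (gL).
apply: (mx_cvg0r_near (g := fun t => (g t)^H)); first exact: gh.
apply/mx_cvg0rP => i j; rewrite adjmxE; under eq_fun do rewrite adjmxE.
by apply: ccvg_conj; have /mx_cvg0rP := gL; apply.
Qed.

Lemma at_right_id : (fun t : R => t) @ 0^'+ --> (0 : R).
Proof. by apply: cvg_at_right_filter; exact: cvg_id. Qed.

Lemma cvg_shift_eps (s : R) : s + 2 * e @[e --> 0^'+] --> s.
Proof.
rewrite -[X in _ --> X]addr0; apply: cvgD; first exact: cvg_cst.
rewrite -[X in _ --> X](mulr0 2); apply: cvgM; first exact: cvg_cst.
exact: at_right_id.
Qed.

Lemma psd_addeps n (A : 'M[C]_n) (e : R) : psdmx A -> 0 < e ->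
  pdmx (A + e%:C%:M).
Proof.
move=> hA e0; have hH := psd_hermitian hA; rewrite -scalemx1.
apply: (pdmx_qle _ e0).
  apply: hermitianD => //; apply: hermitianZ; exact: adjmx1.
by move=> v; rewrite rqD lerDr; have := psd_qle hA v; rewrite rq0.
Qed.

Lemma psd_entry_eq0 n (G : 'M[C]_n) (s : 'I_n -> R) i j :
  hermitian G -> qle 0 G -> qle G (dg s) -> s i = 0 \/ s j = 0 -> G i j = 0.
Proof.
move=> hG G0 Gs.
have D0 k : s k = 0 -> complex.Re (G k k) = 0.
  move=> sk; apply/eqP; rewrite eq_le.
  have := qle_diag k G0; have := qle_diag k Gs.
  by rewrite dgE sk eqxx mulr1n mxE => -> ->.
have E k l : s k = 0 -> G k l = 0.
  move=> /D0 Gk; have := psd_entry k l hG G0; rewrite Gk mul0r => h.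
  by apply/eqP; rewrite -nsq_eq0 eq_le h nsq_ge0.
move=> [/E->//|/E sj]; have /matrixP/(_ i j) := hG.
by rewrite adjmxE sj => <-; exact: conjc0.
Qed.

Section Limit.
Variables (n : nat) (A B : 'M[C]_n).
Hypotheses (hA : psdmx A) (hB : psdmx B).
Variables (U : 'M[C]_n) (s : 'I_n -> R).
Hypotheses (hU : unitarymx U) (s0 : forall i, 0 <= s i).
Hypothesis AB : A + B = udu U s.

Let J (e : R) := udu U (fun i => (Num.sqrt (s i + 2 * e))^-1).
Let T (e : R) := J e *m (A + e%:C%:M) *m J e.

(** [J e] blows up on the kernel of A + B. There A vanishes too, being dominated by A + B, and the
    shift alone contributes e / (2 e): this is the origin of the entries 1 / 2 in [Tm]. The other
    entries converge termwise. *)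
Lemma mean_compression_cvg : exists2 L, hermitian L & mx_cvg0r T L.
Proof.
pose A' := U^H *m A *m U.
have A'0 i j : s i = 0 \/ s j = 0 -> A' i j = 0.
  apply: psd_entry_eq0.
  - by apply: hermitian_conj; exact: psd_hermitian.
  - by rewrite -[0](mul0mx _ U) -(mulmx0 _ U^H); apply: qle_conj; exact: psd_qle.
  - rewrite -(udu_conj s hU) -AB; apply: qle_conj => v.
    by rewrite rqD lerDl; have := psd_qle hB v; rewrite rq0.
pose j e i := (Num.sqrt (s i + 2 * e))^-1.
have TE e : T e = U *m (dg (j e) *m (A' + e%:C%:M) *m dg (j e)) *m U^H.
  have -> : A' + e%:C%:M = U^H *m (A + e%:C%:M) *m U.
    by rewrite mulmxDr mulmxDl -(scalemx1 _ e%:C) -scalemxAr -scalemxAl mulmx1 unitarymxV.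
  by rewrite /T /J uduE !mulmxA.
pose Tm := \matrix_(i, k) if (s i == 0) || (s k == 0)
   then (if i == k then 2^-1 else 0)%:C
   else ((Num.sqrt (s i))^-1)%:C * A' i k * ((Num.sqrt (s k))^-1)%:C.
have TL : mx_cvg0r T (U *m Tm *m U^H).
  rewrite (_ : T = fun e => U *m (dg (j e) *m (A' + e%:C%:M) *m dg (j e)) *m U^H).
    2: exact/funext.
  apply: mx_cvg0r_conj; apply/mx_cvg0rP => i k; rewrite mxE.
  under eq_fun do rewrite mul_mx_dgE mul_dgE addmxE.
  case: ifPn => [/orP h|].
    have {}h : s i = 0 \/ s k = 0 by case: h => /eqP; [left|right].
    rewrite A'0 //.
    suff H : \forall e \near 0^'+,
        (if i == k then 2^-1 else 0)%:C = (j e i)%:C * (0 + e%:C%:M i k) * (j e k)%:C.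
      by apply/ccvgP => d d0; apply: filterS H => e <-; rewrite subrr normr0 ltcR.
    near=> e; rewrite add0r mxE; case: eqP h => [-> h|_ _]; last by rewrite !(mulr0,mul0r).
    have {}h : s k = 0 by case: h.
    rewrite mulr1n -!rmorphM /j h add0r mulrAC -invfM -expr2.
    have e0 : 0 < e by near: e; exact: nbhs_right_gt.
    rewrite sqr_sqrtr ?mulr_ge0 ?ltW //; congr (_%:C).
    by field; rewrite gt_eqF.
  rewrite negb_or => /andP[si sk].
  have jc l : s l != 0 -> j e l @[e --> 0^'+] --> (Num.sqrt (s l))^-1.
    move=> sl; apply: cvgV; first by rewrite sqrtr_eq0 -ltNge lt_neqAle eq_sym sl s0.
    apply: continuous_cvg; first exact: sqrt_continuous.
    exact: cvg_shift_eps.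
  apply: ccvgM; last by apply: ccvg_real; exact: jc.
  apply: ccvgM; first by apply: ccvg_real; exact: jc.
  rewrite -[X in ccvg _ X]addr0; apply: ccvgD; first exact: ccvg_cst.
  under eq_fun do rewrite mxE.
  case: (i == k); last by under eq_fun do rewrite mulr0n; exact: ccvg_cst.
  by under eq_fun do rewrite mulr1n; apply: ccvg_real; exact: at_right_id.
exists (U *m Tm *m U^H) => //.
apply: hermitian_cvg TL _; near=> e.
have := @hermitian_conj _ _ _ (A + e%:C%:M) (J e).
rewrite hermitian_udu; apply; apply: hermitianD; first exact: psd_hermitian.
by rewrite -scalemx1; apply: hermitianZ; exact: adjmx1.
Unshelve. all: by end_near. Qed.

Variable f : R -> R.
Hypothesis f_lim : forall d, exists b, unit_limit (perspective f) d b.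
Hypothesis f_bound : forall x, 0 < x -> x < 1 -> `|perspective f x| <= 1.

Lemma KA_mean_pd_cvg : exists L, mx_cvg0r
  (fun e => KA_mean_pd f (A + e%:C%:M) (B + e%:C%:M)) L.
Proof.
have [L hL TL] := mean_compression_cvg.
have [V [d [hV LE]]] := hermitian_spectral hL.
(* Eigenbases are chosen independently for each [e]; [spectral_cvg] asks for no continuity of this
   choice. *)
have hT e : exists Vt : 'M[C]_n * ('I_n -> R),
    unitarymx Vt.1 /\ T e = udu Vt.1 Vt.2.
  have hTe : hermitian (T e).
    have := @hermitian_conj _ _ _ (A + e%:C%:M) (J e).
    rewrite hermitian_udu; apply; apply: hermitianD; first exact: psd_hermitian.
    by rewrite -scalemx1; apply: hermitianZ; exact: adjmx1.
  by have [W [r h]] := hermitian_spectral hTe; exists (W, r).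
have [Vt hVt] := choice hT.
have [b hb] := choice (fun i => f_lim (d i)).
have pX e : 0 < e -> pdmx (A + e%:C%:M) by exact: psd_addeps.
have pY e : 0 < e -> pdmx (B + e%:C%:M) by exact: psd_addeps.
have XY e : (A + e%:C%:M) + (B + e%:C%:M) = udu U (fun i => s i + 2 * e).
  have -> : (fun i => s i + 2 * e) = (fun i => s i + 2 * e * 1).
    by apply/funext => i; rewrite mulr1.
  rewrite -(uduD U s (fun i => 2 * e * 1)) -(uduZ U (2 * e) (fun=> 1)) -AB.
  have EE : e%:C%:M + e%:C%:M = (2 * e)%:C *: 1%:M :> 'M[C]_n.
    by rewrite -(scalemx1 _ e%:C) -scalerDl -rmorphD mulr_natl mulr2n.
  by rewrite (udu1 hU) addrACA EE.
have sp e : 0 < e -> forall i, 0 < s i + 2 * e.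
  by move=> e0 i; rewrite ltr_wpDl // mulr_gt0.
have tau01 e : 0 < e -> forall i, 0 < (Vt e).2 i /\ (Vt e).2 i < 1.
  move=> e0 i; have [h1 h2] := hVt e; split.
    exact: (mean_eigen_gt0 hU h1 (sp e e0) (pX e e0) h2).
  exact: (mean_eigen_lt1 hU h1 (sp e e0) (pY e e0) (XY e) h2).
pose H e := udu U (fun i => Num.sqrt (s i + 2 * e)).
pose G e := udu (Vt e).1 (fun i => perspective f ((Vt e).2 i)).
exists (udu U (fun i => Num.sqrt (s i)) *m udu V b *m udu U (fun i => Num.sqrt (s i))).
apply: (mx_cvg0r_near (g := fun e => H e *m G e *m H e)).
  near=> e; have e0 : 0 < e by near: e; exact: nbhs_right_gt.
  have [h1 h2] := hVt e.
  by rewrite (KA_mean_pdE hU h1 (sp e e0) (pX e e0) (XY e) h2).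
have HL : mx_cvg0r H (udu U (fun i => Num.sqrt (s i))).
  apply: mx_cvg0r_udu => i; apply: continuous_cvg; first exact: sqrt_continuous.
  exact: cvg_shift_eps.
apply: mx_cvg0rM (HL); apply: mx_cvg0rM HL _.
apply: (@spectral_cvg _ _ V d b 1 (fun e => (Vt e).1) (fun e => (Vt e).2)) => //.
- by near=> e; have [] := hVt e.
- near=> e; have e0 : 0 < e by near: e; exact: nbhs_right_gt.
  by move=> i; have [t0 t1] := tau01 e e0 i; exact: f_bound.
- move=> i x x0; have [de de0 hde] := hb i x x0; exists de => //.
  near=> e; have e0 : 0 < e by near: e; exact: nbhs_right_gt.
  by move=> k hk; have [t0 t1] := tau01 e e0 k; exact: hde.
- rewrite -LE; apply: mx_cvg0r_near TL; near=> e.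
  by have [_] := hVt e.
Unshelve. all: by end_near. Qed.

End Limit.

End MeanOfPositiveSemidefinite.

(** * Arithmetic and harmonic bounds for the mean of semidefinite matrices *)

Section KuboAndoMean.
Variable R : realType.
Local Notation C := R[i].

Lemma mulmx_comb n (c d : C) (P X Y : 'M[C]_n) :
  P *m (c *: X + d *: Y) *m P = c *: (P *m X *m P) + d *: (P *m Y *m P).
Proof.
by rewrite mulmxDr mulmxDl -!scalemxAr -!scalemxAl.
Qed.

Lemma mulmx_conjA n (P Q D : 'M[C]_n) :
  P *m Q *m D *m (Q *m P) = P *m (Q *m D *m Q) *m P.
Proof. by rewrite !mulmxA. Qed.

Lemma qle_sub_comb n (c d : R) (P M X Y X' Y' : 'M[C]_n) : 0 <= c -> 0 <= d ->
  qle (P *m X *m P) (P *m X' *m P) -> qle (P *m Y *m P) (P *m Y' *m P) ->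
  qle (M - P *m (c%:C *: X' + d%:C *: Y') *m P)
      (M - P *m (c%:C *: X + d%:C *: Y) *m P).
Proof.
move=> c0 d0 hX hY v; rewrite [leLHS]rqB [leRHS]rqB lerD2l lerN2.
rewrite mulmx_comb [X in _ <= rq X _]mulmx_comb [leLHS]rqD [leRHS]rqD.
by apply: lerD; rewrite [leLHS]rqZ [leRHS]rqZ; apply: ler_wpM2l.
Qed.

(** Since the inverse of 0 is 0, the right side holds a pseudo-inverse, and the eigenvalue
    inequality fails where [d i = 0]. The hypothesis on [P] inserts the support projection on both
    sides, which removes these entries. *)
Lemma qle_supp_shift n (W P : 'M[C]_n) (d : 'I_n -> R) (e : R) : hermitian P ->
  unitarymx W -> (forall i, 0 <= d i) -> 0 < e ->
  P *m udu W (fun i => (d i != 0)%:R) = P ->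
  qle (P *m udu W (fun i => (d i + e)^-1) *m P)
      (P *m udu W (fun i => (d i)^-1) *m P).
Proof.
move=> hP hW d0 e0 PW; set S := udu W _ in PW.
have PW' : S *m P = P.
  by have := congr1 (@adjmx R n n) PW; rewrite adjmxM hermitian_udu hP.
set D := udu W (fun i => (d i + e)^-1).
have E : P *m D *m P = P^H *m (S *m D *m S) *m P.
  by rewrite hP -mulmx_conjA PW PW'.
rewrite {}E -{3}hP.
rewrite /S /D !(uduM _ _ hW); apply: qle_conj; apply: qle_udu => i.
have [->|di] := eqVneq (d i) 0; first by rewrite mul0r mulr0 invr0.
rewrite mul1r mulr1 lef_pV2 ?posrE ?lerDl ?(ltW e0) //.
  by rewrite ltr_wpDl.
by rewrite lt_neqAle eq_sym di d0.
Qed.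

Lemma pdmxD n (X Y : 'M[C]_n) : pdmx X -> pdmx Y -> pdmx (X + Y).
Proof.
move=> hX hY v v0; rewrite mulmxDr mulmxDl addmxE.
exact: addr_gt0 (hX v v0) (hY v v0).
Qed.

Lemma mean_spectral_data n (X Y : 'M[C]_n) : pdmx X -> pdmx Y ->
  exists U V s tau, [/\ unitarymx U, unitarymx V, forall i, 0 < s i,
    X + Y = udu U s &
    udu U (fun i => (Num.sqrt (s i))^-1) *m X *m
    udu U (fun i => (Num.sqrt (s i))^-1) = udu V tau].
Proof.
move=> hX hY; have [U [s [hU s0 XY]]] := pd_spectral (pdmxD hX hY).
pose J := udu U (fun i => (Num.sqrt (s i))^-1).
have hT : hermitian (J *m X *m J).
  have := @hermitian_conj _ _ _ X J; rewrite hermitian_udu; apply.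
  exact/psd_hermitian/psd_pdmx.
have [V [tau [hV E]]] := hermitian_spectral hT.
by exists U, V, s, tau; split.
Qed.

Variables (f : R -> R) (al : R).
Hypotheses (hf : KA_function f) (hder : is_derive (1 : R) 1 f al).
Hypotheses (al0 : 0 < al) (al1 : al < 1).

Let f_mono : operator_monotone f. Proof. by case: hf. Qed.
Let f1 : f 1 = 1. Proof. by case: hf => _ []. Qed.
Let f_ge0 (x : R) : 0 < x -> 0 <= f x.
Proof. by case: hf => _ [h _] /ltW; exact: h. Qed.
Let f_ub (x : R) : 0 < x -> f x <= 1 + al * (x - 1).
Proof. exact: operator_monotone_tangent. Qed.
Let f_lb (x : R) : 0 < x -> ((1 - al) + al / x)^-1 <= f x.
Proof. by move=> x0; exact: operator_monotone_harmonic. Qed.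

Variables (n : nat) (A B : 'M[C]_n).
Hypotheses (hA : psdmx A) (hB : psdmx B).

(** [mx_lim0r] returns 0 when no limit exists, so existence has to come before any estimate of
    [KA_mean]. *)
Lemma KA_mean_cvg : mx_cvg0r
  (fun e => KA_mean_pd f (A + e%:C%:M) (B + e%:C%:M)) (KA_mean f A B).
Proof.
have hAB : psdmx (A + B).
  move=> v; rewrite mulmxDr mulmxDl addmxE.
  exact: addr_ge0 (hA v) (hB v).
have [U [s [hU s0 AB]]] := psd_spectral hAB.
have [||L HL] := KA_mean_pd_cvg hA hB hU s0 AB (f := f).
- apply: (perspective_limit (al := al)) => // x y.
  + exact: operator_monotone_le.
  + exact: operator_monotone_div_le.
- move=> x x0 x1; rewrite ger0_norm; last exact: perspective_ge0.
  exact: (perspective_le1 (al := al)).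
by rewrite /KA_mean (mx_lim0rE HL).
Qed.

Let pA (e : R) : 0 < e -> pdmx (A + e%:C%:M). Proof. exact: psd_addeps. Qed.
Let pB (e : R) : 0 < e -> pdmx (B + e%:C%:M). Proof. exact: psd_addeps. Qed.

Lemma KA_mean_hermitian : hermitian (KA_mean f A B).
Proof.
apply: hermitian_cvg KA_mean_cvg _; near=> e.
have e0 : 0 < e by near: e; exact: nbhs_right_gt.
have [U [V [s [tau [hU hV s0 XY hT]]]]] := mean_spectral_data (pA e0) (pB e0).
exact: (KA_mean_pd_hermitian hU hV s0 (pA e0) XY hT).
Unshelve. all: by end_near. Qed.

Lemma KA_mean_le_arith :
  qle (KA_mean f A B) ((1 - al)%:C *: A + al%:C *: B).
Proof.
have HR : mx_cvg0r
    (fun e => ((1 - al)%:C *: A + al%:C *: B) + udu 1%:M (fun=> e))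
    (((1 - al)%:C *: A + al%:C *: B) + udu 1%:M (fun=> 0)).
  apply: mx_cvg0rD; first exact: mx_cvg0r_cst.
  by apply: mx_cvg0r_udu => _; exact: at_right_id.
rewrite udu0 addr0 in HR.
apply: qle_cvg KA_mean_cvg HR _; near=> e.
have e0 : 0 < e by near: e; exact: nbhs_right_gt.
have [U [V [s [tau [hU hV s0 XY hT]]]]] := mean_spectral_data (pA e0) (pB e0).
have := KA_mean_pd_arith hU hV s0 (pA e0) (pB e0) XY hT f_ub.
rewrite (_ : (1 - al)%:C *: _ + _ = (1 - al)%:C *: A + al%:C *: B + udu 1%:M (fun=> e)) //.
have E1 : udu 1%:M (fun=> e) = e%:C%:M :> 'M[C]_n.
  have h1 : unitarymx (1%:M : 'M[C]_n) by rewrite /unitarymx mul1mx adjmx1.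
  rewrite -(scalemx1 _ e%:C) -[X in _ *: X](udu1 h1) uduZ; apply: eq_udu => i.
  by rewrite mulr1.
rewrite !scalerDr addrACA E1 -scalerDl -rmorphD subrK rmorph1 scale1r.
exact: erefl.
Unshelve. all: by end_near. Qed.

(** Below both supports, the inverses of the shifted matrices are dominated by pseudo-inverses
    independent of the shift, so the limit only concerns the right side. *)
Lemma KA_mean_ge_harm (P UA UB : 'M[C]_n) (a b : 'I_n -> R) :
  hermitian P -> unitarymx UA -> unitarymx UB ->
  (forall i, 0 <= a i) -> (forall i, 0 <= b i) ->
  A = udu UA a -> B = udu UB b ->
  P *m udu UA (fun i => (a i != 0)%:R) = P ->
  P *m udu UB (fun i => (b i != 0)%:R) = P ->
  qle (P + P - P *m ((1 - al)%:C *: udu UA (fun i => (a i)^-1) +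
                     al%:C *: udu UB (fun i => (b i)^-1)) *m P)
      (KA_mean f A B).
Proof.
move=> hP hUA hUB a0 b0 EA EB PA PB.
apply: qle_cvg (mx_cvg0r_cst _) KA_mean_cvg _; near=> e.
have e0 : 0 < e by near: e; exact: nbhs_right_gt.
have [U [V [s [tau [hU hV s0 XY hT]]]]] := mean_spectral_data (pA e0) (pB e0).
have shift (W M : 'M[C]_n) (d : 'I_n -> R) : unitarymx W ->
    (forall i, 0 <= d i) -> M = udu W d ->
    (M + e%:C%:M) *m udu W (fun i => (d i + e)^-1) = 1%:M.
  move=> hW d0 ->; rewrite -(scalemx1 _ e%:C) -(udu1 hW) uduZ uduD.
  rewrite (uduM _ _ hW); apply: eq_udu => i.
  by rewrite mulr1 divff // gt_eqF // ltr_wpDl.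
have XX' := shift _ _ _ hUA a0 EA; have YY' := shift _ _ _ hUB b0 EB.
apply: qle_trans (KA_mean_pd_harm hU hV s0 (pA e0) (pB e0) XY hT al0 al1 f_lb
  XX' YY' hP).
have h1 := qle_supp_shift hP hUA a0 e0 PA.
have h2 := qle_supp_shift hP hUB b0 e0 PB.
have al1' : 0 <= 1 - al by rewrite subr_ge0 ltW.
exact: (qle_sub_comb (P + P) al1' (ltW al0) h1 h2).
Unshelve. all: by end_near. Qed.

Lemma KA_mean_ge0 : qle 0 (KA_mean f A B).
Proof.
have [UA [a [hUA a0 EA]]] := psd_spectral hA.
have [UB [b [hUB b0 EB]]] := psd_spectral hB.
(* For [P = 0] the harmonic bound reduces to nonnegativity. *)
have := KA_mean_ge_harm (adjmx0 _ _ _) hUA hUB a0 b0 EA EB (mul0mx _ _) (mul0mx _ _).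
by rewrite !mul0mx subr0 addr0.
Qed.

End KuboAndoMean.

(** * Support projections, their meet and simultaneous diagonalization *)

Section Projections.
Variable R : realType.
Local Notation C := R[i].

(** Each projection absorbs the other on the left, and taking adjoints identifies them; this pins
    down the values chosen by [xget] in [suppmx] and [projmeet]. Transposes appear because row
    spaces stand for ranges. *)
Lemma orthproj_unique n (S S' M : 'M[C]_n) : orthproj S -> orthproj S' ->
  (S^T :=: M)%MS -> (S'^T :=: M)%MS -> S = S'.
Proof.
move=> [hS SS] [hS' SS'] SM SM'.
have absorb (P Q : 'M[C]_n) : Q *m Q = Q -> (P^T <= Q^T)%MS -> Q *m P = P.
  move=> QQ /submxP[D PE]; rewrite -[P]trmxK PE trmx_mul trmxK mulmxA QQ.
  exact: erefl.
have h1 : S' *m S = S by apply: absorb => //; rewrite SM SM'.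
have h2 : S *m S' = S' by apply: absorb => //; rewrite SM SM'.
by rewrite -hS -h1 adjmxM hS hS' h2.
Qed.

Lemma orthproj_udu n (U : 'M[C]_n) (b : 'I_n -> bool) : unitarymx U ->
  orthproj (udu U (fun i => (b i)%:R)).
Proof.
move=> hU; split; first exact: hermitian_udu.
rewrite (uduM _ _ hU); apply: eq_udu => i.
by case: (b i); rewrite ?mulr1 ?mulr0.
Qed.

Lemma suppmx_udu n (U : 'M[C]_n) d : unitarymx U ->
  suppmx (udu U d) = udu U (fun i => (d i != 0)%:R).
Proof.
move=> hU; set A := udu U d; set S := udu U _.
have SA : (S^T :=: A^T)%MS.
  apply/eqmxP/andP; split; apply/submxP.
    exists (udu U (fun i => (d i)^-1))^T; rewrite -trmx_mul (uduM _ _ hU).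
    congr trmx; apply: eq_udu => i.
    by have [->|di] := eqVneq (d i) 0; rewrite ?mul0r ?divff.
  exists A^T; rewrite -trmx_mul (uduM _ _ hU); congr trmx; apply: eq_udu => i.
  by have [->|di] := eqVneq (d i) 0; rewrite ?mul0r ?mul1r.
have [h1 h2] : orthproj (suppmx A) /\ ((suppmx A)^T :=: A^T)%MS.
  apply: (@xgetPex _ 0 [set P | orthproj P /\ (P^T :=: A^T)%MS]).
  by exists S; split=> //; exact: orthproj_udu.
exact: (orthproj_unique h1 (orthproj_udu _ hU) h2 SA).
Qed.

Lemma rq_eq0_mx n m (M : 'M[C]_(m, n)) :
  (forall v, rq (M^H *m M) v = 0) -> M = 0.
Proof.
move=> H; apply/matrixP => i j.
have : M *m delta_mx j (0 : 'I_1) = 0.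
  apply: rq1_eq0; have := H (delta_mx j 0).
  by rewrite -[M^H]mulmx1 rq_conj.
by move=> /matrixP/(_ i 0); rewrite -colE !mxE.
Qed.

Lemma orthproj_compl n (P : 'M[C]_n) : orthproj P ->
  (1%:M - P)^H *m (1%:M - P) = 1%:M - P.
Proof.
move=> [hP PP]; rewrite adjmxB adjmx1 hP mulmxBl !mulmxBr !mulmx1 mul1mx PP.
by rewrite subrr subr0.
Qed.

Lemma orthproj_le1 n (P : 'M[C]_n) : orthproj P -> qle P 1%:M.
Proof.
move=> hP v; rewrite -subr_ge0 -rqB -(orthproj_compl hP).
exact: rq_gram_ge0.
Qed.

Lemma udu_fixed n m (U : 'M[C]_n) d c (X : 'M[C]_(n, m)) : unitarymx U ->
  udu U d *m X = c%:C *: X -> udu U (fun i => (d i == c)%:R) *m X = X.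
Proof.
move=> hU H; pose Y := U^H *m X.
have XE : X = U *m Y by rewrite /Y mulmxA hU mul1mx.
have HY : dg d *m Y = c%:C *: Y.
  rewrite /Y scalemxAr -H uduE !mulmxA unitarymxV // mul1mx.
  exact: erefl.
have HY' : dg (fun i => (d i == c)%:R) *m Y = Y.
  apply/matrixP => i j; have /matrixP/(_ i j) := HY.
  rewrite !mul_dgE scalemxE; have [->|dc] := eqVneq (d i) c.
    by rewrite rmorph1 mul1r.
  have [->|Y0] := eqVneq (Y i j) 0; first by rewrite !mulr0.
  by move=> /(mulIf Y0)/complexI dE; move: dc; rewrite dE eqxx.
by rewrite uduE -!mulmxA -/Y HY' -XE.
Qed.

Section Meet.
Variables (n : nat) (P Q : 'M[C]_n) (al : R) (W : 'M[C]_n) (q : 'I_n -> R).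
Hypotheses (hP : orthproj P) (hQ : orthproj Q) (al0 : 0 < al) (al1 : al < 1).
Hypotheses (hW : unitarymx W) (E : (1 - al)%:C *: P + al%:C *: Q = udu W q).
Let P0 := udu W (fun i => (q i == 1)%:R).

Lemma convex_proj_eigen_le1 i : q i <= 1.
Proof.
apply: (@udu_eigen_le _ _ W) => //; rewrite -E scale1r => v.
rewrite rqD !rqZ; have := orthproj_le1 hP v; have := orthproj_le1 hQ v.
move: (rq P v) (rq Q v) (rq 1%:M v) => x y z yz xz.
have : (1 - al) * x <= (1 - al) * z by rewrite ler_wpM2l // subr_ge0 ltW.
have : al * y <= al * z by rewrite ler_wpM2l // ltW.
by lra.
Qed.

(** For w = P0 v, the identity Q' w = w with Q' the convex combination gives (1 - al) |(1 - P) w|^2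
    + al |(1 - Q) w|^2 = 0, and both weights are positive. *)
Lemma convex_proj_fixed : P *m P0 = P0 /\ Q *m P0 = P0.
Proof.
have hP0 : orthproj P0 by exact: orthproj_udu.
have EP0 : ((1 - al)%:C *: P + al%:C *: Q) *m P0 = P0.
  rewrite E (uduM _ _ hW); apply: eq_udu => i.
  by case: eqP => [->|_]; rewrite ?mulr1 ?mulr0.
pose MP := (1%:M - P) *m P0; pose MQ := (1%:M - Q) *m P0.
have gram (T : 'M[C]_n) : orthproj T ->
    ((1%:M - T) *m P0)^H *m ((1%:M - T) *m P0) = P0^H *m (1%:M - T) *m P0.
  move=> hT; rewrite adjmxM mulmxA -[_ *m _ *m (1%:M - T)]mulmxA.
  by rewrite orthproj_compl.
have sum0 v : (1 - al) * rq (MP^H *m MP) v + al * rq (MQ^H *m MQ) v = 0.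
  rewrite (gram _ hP) (gram _ hQ) !rq_conj !rqB.
  set w := P0 *m v.
  have : rq ((1 - al)%:C *: P + al%:C *: Q) w = rq 1%:M w.
    rewrite /rq mulmx1 -[_ *m _ *m w]mulmxA {1}/w [_ *m (P0 *m v)]mulmxA EP0.
    exact: erefl.
  rewrite rqD !rqZ; move: (rq P w) (rq Q w) (rq 1%:M w) => x y z; lra.
have b0 v : 0 <= rq (MP^H *m MP) v /\ 0 <= rq (MQ^H *m MQ) v.
  by split; exact: rq_gram_ge0.
have MP0 : MP = 0.
  apply: rq_eq0_mx => v; have := sum0 v; have [] := b0 v.
  move: (rq _ v) (rq _ v) => x y x0 y0 /eqP.
  rewrite paddr_eq0; last 2 first.
  - by rewrite mulr_ge0 // subr_ge0 ltW.
  - by rewrite mulr_ge0 // ltW.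
  move=> /andP[/eqP + _] => /eqP.
  by rewrite mulf_eq0 gt_eqF ?subr_gt0 //= => /eqP.
have MQ0 : MQ = 0.
  apply: rq_eq0_mx => v; have := sum0 v; have [] := b0 v.
  move: (rq _ v) (rq _ v) => x y x0 y0 /eqP.
  rewrite paddr_eq0; last 2 first.
  - by rewrite mulr_ge0 // subr_ge0 ltW.
  - by rewrite mulr_ge0 // ltW.
  by move=> /andP[_]; rewrite mulf_eq0 gt_eqF //= => /eqP.
split; apply/eqP; rewrite eq_sym -subr_eq0.
  by have := MP0; rewrite /MP mulmxBl mul1mx => ->.
by have := MQ0; rewrite /MQ mulmxBl mul1mx => ->.
Qed.

(** One inclusion is [convex_proj_fixed]; conversely a vector fixed by both projections is fixed by
    their convex combination, hence lies in its eigenspace for 1. The meet thus comes with a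
    spectral gap, which is used for the upper bound. *)
Lemma projmeet_udu : projmeet P Q = P0.
Proof.
have [PP0 QP0] := convex_proj_fixed.
have hP0 : orthproj P0 by exact: orthproj_udu.
have SM : (P0^T :=: (P^T :&: Q^T))%MS.
  apply/eqmxP/andP; split.
    rewrite sub_capmx -{1}PP0 -[X in _ && (X^T <= _)%MS]QP0 !trmx_mul.
    by rewrite !submxMl.
  set V := (P^T :&: Q^T)%MS.
  have fix_of (T : 'M[C]_n) : T *m T = T -> (V <= T^T)%MS -> T *m V^T = V^T.
    move=> TT /submxP[D ->]; rewrite trmx_mul trmxK mulmxA TT.
    exact: erefl.
  have fP : P *m V^T = V^T by apply: fix_of (capmxSl _ _); case: hP.
  have fQ : Q *m V^T = V^T by apply: fix_of (capmxSr _ _); case: hQ.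
  have fE : udu W q *m V^T = (1 : R)%:C *: V^T.
    rewrite -E mulmxDl -!scalemxAl fP fQ -scalerDl -rmorphD subrK.
    exact: erefl.
  have := udu_fixed hW fE; rewrite -/P0 => fP0.
  by rewrite -[V]trmxK -fP0 trmx_mul submxMl.
have [h1 h2] : orthproj (projmeet P Q) /\
    ((projmeet P Q)^T :=: (P^T :&: Q^T))%MS.
  apply: (@xgetPex _ 0 [set S | orthproj S /\ (S^T :=: (P^T :&: Q^T))%MS]).
  by exists P0.
exact: (orthproj_unique h1 hP0 h2 SM).
Qed.

End Meet.

(* Adding [kappa (1 - P)] with [kappa] above the spectrum of [K] separates
   the range of [P] from its complement inside the spectrum. *)
Lemma proj_simultaneous n (P K : 'M[C]_n) : orthproj P -> hermitian K ->
  P *m K = K -> K *m P = K ->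
  exists U (b : 'I_n -> bool) k, [/\ unitarymx U,
    P = udu U (fun i => (b i)%:R), K = udu U k & forall i, ~~ b i -> k i = 0].
Proof.
move=> [hP PP] hK PK KP; have [V [k' [hV KE]]] := hermitian_spectral hK.
pose kap := 1 + \sum_i `|k' i|.
have kap_neq i : k' i == kap = false.
  apply/negbTE; rewrite lt_eqF // /kap (bigD1 i) //= addrCA.
  apply: (le_lt_trans (ler_norm _)).
  by rewrite ltrDl ltr_pwDl // sumr_ge0.
pose X := 1%:M - P.
have hX : hermitian X by apply: hermitianB => //; exact: adjmx1.
have hH : hermitian (K + kap%:C *: X) by apply: hermitianD => //; exact: hermitianZ.
have [U [h [hU HE]]] := hermitian_spectral hH.
pose E := udu U (fun i => (h i == kap)%:R).
have XX : X *m X = X by rewrite -{1}hX; exact: orthproj_compl.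
have EX : E *m X = X.
  apply: udu_fixed => //; rewrite -HE mulmxDl -scalemxAl XX.
  by rewrite mulmxBr mulmx1 KP subrr add0r.
have XE : X *m E = X.
  by have := congr1 (@adjmx R n n) EX; rewrite adjmxM hX hermitian_udu.
(* The columns of [P *m E] satisfy the eigenvector equation of [K] for [kap], which is not an
   eigenvalue of [K]; hence they vanish. *)
have PE0 : P *m E = 0.
  have HEE : (K + kap%:C *: X) *m E = kap%:C *: E.
    rewrite HE uduZ (uduM _ _ hU); apply: eq_udu => i.
    by have [->|] := eqVneq (h i) kap; rewrite ?mulr0.
  have KPE : K *m (P *m E) = kap%:C *: (P *m E).
    have -> : K *m (P *m E) = kap%:C *: E - kap%:C *: (X *m E).
      by rewrite -HEE mulmxDl -scalemxAl addrK mulmxA KP.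
    rewrite -scalerBr; congr (_ *: _).
    by rewrite mulmxBl mul1mx subKr.
  rewrite KE in KPE; rewrite -(udu_fixed hV KPE).
  by under eq_udu do rewrite kap_neq; rewrite udu0 mul0mx.
have EE : E = X.
  by rewrite -XE mulmxBl mul1mx PE0 subr0.
have PE : P = udu U (fun i => (h i != kap)%:R).
  have -> : P = 1%:M + (-1)%:C *: X.
    by rewrite rmorphN rmorph1 scaleN1r subKr.
  rewrite -EE -(udu1 hU) uduZ uduD; apply: eq_udu => i.
  by case: (h i == kap); rewrite /= ?mulr1 ?mulr0 ?subrr ?addr0.
exists U, (fun i => h i != kap), (fun i => h i + - kap * (h i == kap)%:R).
split=> //.
  rewrite -uduD -uduZ -/E EE -HE rmorphN scaleNr addrK.
  exact: erefl.
by move=> i; rewrite negbK => /eqP ->; rewrite eqxx mulr1 subrr.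
Qed.

End Projections.

(** * Squeezing in the quadratic-form order, and limits of scalar powers z^(1/p) *)

Section PowerLimit.
Variable R : realType.
Local Notation C := R[i].

Lemma cvg_mull0 (a : R) : a * p @[p --> 0^'+] --> (0 : R).
Proof.
rewrite -[X in _ --> X](mulr0 a); apply: cvgM; first exact: cvg_cst.
exact: at_right_id.
Qed.

(** The difference to the lower bound is positive semidefinite with diagonal at most [m - l], and
    [psd_entry] transfers this smallness to the off-diagonal entries. *)
Lemma sandwich_cvg n (U : 'M[C]_n) (X : R -> 'M[C]_n) (l m : R -> 'I_n -> R) d :
  unitarymx U ->
  (\forall p \near 0^'+, [/\ hermitian (X p), qle (udu U (l p)) (X p) &
     qle (X p) (udu U (m p))]) ->
  (forall i, l p i @[p --> 0^'+] --> d i) ->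
  (forall i, m p i @[p --> 0^'+] --> d i) ->
  mx_cvg0r X (udu U d).
Proof.
move=> hU hX hl hm; pose G p := U^H *m X p *m U - dg (l p).
have G0 : mx_cvg0r G 0.
  apply/mx_cvg0rP => i j; apply/ccvgP => e e0; rewrite mxE.
  have gi k : m p k - l p k @[p --> 0^'+] --> (0 : R).
    by rewrite -[X in _ --> X](subrr (d k)); apply: cvgB.
  have H : (m p i - l p i) * (m p j - l p j + 1) @[p --> 0^'+] --> (0 : R).
    rewrite -[X in _ --> X](mul0r (0 + 1)); apply: cvgM => //.
    by apply: cvgD => //; exact: cvg_cst.
  have e20 : 0 < (e / 2) ^+ 2 by rewrite exprn_gt0 // divr_gt0.
  move/cvgrPdist_lt/(_ _ e20) : H => H.
  near=> p.
  have [hXp lX Xm] : [/\ hermitian (X p), qle (udu U (l p)) (X p) &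
     qle (X p) (udu U (m p))] by near: p.
  have hG : hermitian (G p).
    by apply: hermitianB; [exact: hermitian_conj|exact: hermitian_dg].
  have Gge : qle 0 (G p).
    move=> v; rewrite rq0 rqB subr_ge0 -(udu_conj (l p) hU).
    exact: qle_conj.
  have Gle k : complex.Re (G p k k) <= m p k - l p k.
    have : qle (G p) (dg (m p) - dg (l p)).
      move=> v; rewrite [leLHS]rqB [leRHS]rqB lerD2r -(udu_conj (m p) hU).
      exact: qle_conj.
    move=> /(@qle_diag _ _ _ _ k) /le_trans; apply.
    by rewrite addmxE oppmxE !dgE eqxx !mulr1n.
  have Gk k : 0 <= complex.Re (G p k k).
    by have := qle_diag k Gge; rewrite mxE.
  have lt_e : (m p i - l p i) * (m p j - l p j + 1) < (e / 2) ^+ 2.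
    have : `|0 - (m p i - l p i) * (m p j - l p j + 1)| < (e / 2) ^+ 2 by near: p.
    by rewrite sub0r normrN; apply: le_lt_trans (ler_norm _).
  rewrite subr0; apply: (@le_lt_trans _ _ (e / 2)%:C); last first.
    by rewrite ltcR ltr_pdivrMr // mulr_natr mulr2n ltrDl.
  apply: nsq_norm_le; first by rewrite divr_ge0 // ltW.
  apply: le_trans (psd_entry i j hG Gge) _; apply: le_trans (ltW lt_e).
  by apply: ler_pM => //; [rewrite addr_ge0|rewrite lerD2r].
have : mx_cvg0r (fun p => U *m (G p + dg (l p)) *m U^H) (U *m (0 + dg d) *m U^H).
  by apply: mx_cvg0r_conj; apply: mx_cvg0rD G0 _; exact: mx_cvg0r_dg.
rewrite add0r -uduE; apply: mx_cvg0r_near; near=> p.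
by rewrite /G subrK !mulmxA hU mul1mx -mulmxA hU mulmx1.
Unshelve. all: by end_near. Qed.

Lemma powR_root_le (z p y : R) : 0 <= z -> 0 < p -> z = 1 + p * y ->
  z `^ p^-1 <= expR y.
Proof.
move=> z0 p0 zE; move: z0; rewrite le_eqVlt => /predU1P[<-|z0].
  by rewrite powR0 ?expR_ge0 // invr_eq0 gt_eqF.
rewrite /powR gt_eqF // ler_expR ler_pdivrMl //.
by have := @le_ln1Dx R (p * y); rewrite -zE; apply; move: z0; rewrite zE; lra.
Qed.

(** The inequality ln(1 + x) <= x at x = 1 / z - 1 gives ln z >= 1 - 1 / z = p y / z. *)
Lemma powR_root_ge (z p y : R) : 0 < z -> 0 < p -> z = 1 + p * y ->
  expR (y / z) <= z `^ p^-1.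
Proof.
move=> z0 p0 zE; rewrite /powR gt_eqF // ler_expR ler_pdivlMl //.
have iz0 : 0 < z^-1 by rewrite invr_gt0.
have := @le_ln1Dx R (z^-1 - 1); rewrite addrCA subrr addr0 lnV ?posrE // => H.
have -> : p * (y / z) = 1 - z^-1.
  have -> : y = (z - 1) / p by rewrite zE; field; rewrite gt_eqF.
  by field; rewrite !gt_eqF.
by have : - ln z <= z^-1 - 1 by [apply: H; lra]; lra.
Qed.

(* [nu^-1] is the value at [s] of the resolvent of [(z - 1) / p]. *)
Lemma root_limit_pos (k s : R) (e : R) : k + 1 <= s -> 0 < e ->
  exists2 de : R, 0 < de & \forall p \near 0^'+, forall nu z : R, 0 <= z ->
    z = 1 + p * (s - nu) -> 2^-1 <= nu -> `|nu^-1 - (s - k)^-1| < de ->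
    `|z `^ p^-1 - expR k| < e.
Proof.
move=> sk e0; pose m := s - k.
have m1 : 1 <= m by rewrite /m; lra.
have m0 : 0 < m by apply: lt_le_trans m1.
have /cvgrPdist_lt/(_ _ e0)/nbhs_ballP[eta1 /= eta10 heta] : expR y @[y --> k] --> expR k.
  exact: continuous_expR.
pose eta := eta1 / 2; have eta0 : 0 < eta by rewrite divr_gt0.
have etaE : eta < eta1 by rewrite /eta ltr_pdivrMr // mulr_natr mulr2n ltrDl.
pose Y := `|k| + eta.
have Y0 : 0 < Y by rewrite ltr_wpDl.
(* The first bound forces [nu <= 2 * m], so that closeness of the inverses can be undone; the second
   then yields [|y - k| <= eta / 2], because y - k = (1 / nu - 1 / m) nu m. *)
pose de := Num.min (1 / (2 * m)) (eta / (4 * m ^+ 2)).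
have de0 : 0 < de by rewrite lt_min !divr_gt0 ?mulr_gt0 ?exprn_gt0.
exists de => //; near=> p.
have p0 : 0 < p by near: p; exact: nbhs_right_gt.
(* This bound gives |p y| <= 1 / 2, hence z >= 1 / 2; the next one makes the difference p y^2 / z
   between y and y / z at most [eta / 2]. *)
have pY : p * Y <= 1 / 2.
  rewrite -ler_pdivlMr //; near: p; apply: nbhs_right_le.
  by rewrite !divr_gt0.
have pY2 : p * (4 * Y ^+ 2) <= eta.
  rewrite -ler_pdivlMr ?mulr_gt0 ?exprn_gt0 //; near: p; apply: nbhs_right_le.
  by rewrite !divr_gt0 // mulr_gt0 ?exprn_gt0.
move=> nu z z0 zE nu12 hnu; have nu0 : 0 < nu by apply: lt_le_trans nu12; lra.
have hm : `|nu^-1 - m^-1| < de by [].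
have d1 : de <= 1 / (2 * m) by rewrite ge_min lexx.
have d2 : de <= eta / (4 * m ^+ 2) by rewrite ge_min lexx orbT.
have nu2m : nu <= 2 * m.
  rewrite -[nu]invrK -[2 * m]invrK lef_pV2 ?posrE ?invr_gt0 ?mulr_gt0 //.
  have : m^-1 - nu^-1 <= 1 / (2 * m).
    by apply: le_trans d1; apply: le_trans (ltW hm); rewrite distrC ler_norm.
  have -> : m^-1 = 2 * (2 * m)^-1 by field; rewrite gt_eqF.
  by rewrite div1r; lra.
set y := s - nu in zE.
have yk : `|y - k| <= eta / 2.
  have -> : y - k = (nu^-1 - m^-1) * (nu * m).
    by rewrite /y /m; field; rewrite !gt_eqF // -/m.
  rewrite normrM [`|nu * m|]gtr0_norm ?mulr_gt0 //.
  apply: (@le_trans _ _ (eta / (4 * m ^+ 2) * (2 * m * m))).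
    apply: ler_pM => //; first by rewrite mulr_ge0 // ltW.
      by apply: le_trans d2; exact: ltW.
    by rewrite ler_pM2r.
  by rewrite le_eqVlt; apply/orP; left; apply/eqP; field; rewrite gt_eqF.
have yY : `|y| <= Y.
  have -> : y = k + (y - k) by lra.
  apply: le_trans (ler_normD _ _) _; rewrite /Y lerD2l.
  by apply: le_trans yk _; lra.
have py : `|p * y| <= 1 / 2.
  by apply: le_trans pY; rewrite normrM (gtr0_norm p0) ler_pM2l.
have zge : 1 / 2 <= z by move: py; rewrite zE ler_norml => /andP[]; lra.
have z0' : 0 < z by apply: lt_le_trans zge; lra.
have yz : `|y / z - y| <= eta / 2.
  have -> : y / z - y = - (p * (y * y)) / z.
    have -> : p * (y * y) = (z - 1) * y by rewrite zE; ring.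
    by field; rewrite gt_eqF.
  rewrite normrM normrN normfV (gtr0_norm z0') normrM (gtr0_norm p0) normrM.
  rewrite ler_pdivrMr //.
  have : p * (`|y| * `|y|) <= p * Y ^+ 2.
    by rewrite ler_pM2l // expr2 ler_pM.
  have : eta / 2 * (1 / 2) <= eta / 2 * z by rewrite ler_pM2l // divr_gt0.
  by lra.
have up := powR_root_le (ltW z0') p0 zE; have lo := powR_root_ge z0' p0 zE.
have h1 : `|expR k - expR y| < e.
  apply: heta; rewrite /ball /= distrC; apply: le_lt_trans yk _; lra.
have h2 : `|expR k - expR (y / z)| < e.
  apply: heta; rewrite /ball /= distrC.
  have -> : y / z - k = (y / z - y) + (y - k) by lra.
  apply: le_lt_trans (ler_normD _ _) _.
  by apply: le_lt_trans (lerD yz yk) _; rewrite -splitr.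
move: h1 h2 up lo; rewrite !ltr_norml.
move: (expR _) (expR _) (expR _) (_ `^ _); clear => u v w x /andP[? ?] /andP[? ?] ? ?.
by apply/andP; split; lra.
Unshelve. all: by end_near. Qed.

(** The estimate z^(1/p) <= exp(s - nu) <= exp(s) / nu is uniform in [p]. *)
Lemma root_limit0 (s : R) (e : R) : 0 < e ->
  exists2 de : R, 0 < de & forall p nu z : R, 0 < p -> 0 <= z ->
    z = 1 + p * (s - nu) -> 0 < nu -> `|nu^-1 - 0| < de ->
    `|z `^ p^-1 - 0| < e.
Proof.
move=> e0; exists (e / expR s); first by rewrite divr_gt0 ?expR_gt0.
move=> p nu z p0 z0 zE nu0; rewrite !subr0 gtr0_norm ?invr_gt0 // => h.
rewrite ger0_norm ?powR_ge0 //; apply: le_lt_trans (powR_root_le z0 p0 zE) _.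
rewrite expRD expRN; apply: (@le_lt_trans _ _ (expR s * nu^-1)).
  rewrite ler_pM2l ?expR_gt0 // lef_pV2 ?posrE ?expR_gt0 //.
  by apply: le_trans (expR_ge1Dx nu); rewrite lerDr.
by move: h; rewrite ltr_pdivlMr ?expR_gt0 // mulrC.
Qed.

End PowerLimit.

(** * From two-sided bounds on Z_p to the limit of its power 1 / p *)

Section PowerConvergence.
Variable R : realType.
Local Notation C := R[i].

Lemma inv_affine_cvg0 (s c : R) : 0 < c ->
  (s + c / p)^-1 @[p --> 0^'+] --> (0 : R).
Proof.
move=> c0; have H : p * (s * p + c)^-1 @[p --> 0^'+] --> (0 : R).
  rewrite -[X in _ --> X](mul0r (0 + c)^-1); apply: cvgM; first exact: at_right_id.
  apply: cvgV; first by rewrite add0r gt_eqF.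
  by apply: cvgD; [exact: cvg_mull0|exact: cvg_cst].
apply: cvg_trans H; apply: near_eq_cvg; near=> p.
have p0 : 0 < p by near: p; exact: nbhs_right_gt.
have -> : s + c / p = (s * p + c) / p by field; rewrite gt_eqF.
by rewrite invfM invrK mulrC.
Unshelve. all: by end_near. Qed.

Lemma ler_sum_norm n (k : 'I_n -> R) i : `|k i| <= \sum_j `|k j|.
Proof. by rewrite (bigD1 i) //= lerDl sumr_ge0. Qed.

Lemma qle_affine n (c d : R) (X Y : 'M[C]_n) : 0 <= d -> qle X Y ->
  qle (c%:C *: 1%:M - d%:C *: Y) (c%:C *: 1%:M - d%:C *: X).
Proof.
move=> d0 XY v; rewrite [leLHS]rqB [leRHS]rqB lerD2l lerN2 [leLHS]rqZ [leRHS]rqZ.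
exact: ler_wpM2l.
Qed.

Lemma udu_affine n (U : 'M[C]_n) (c e : R) d : unitarymx U ->
  c%:C *: 1%:M - e%:C *: udu U d = udu U (fun i => c - e * d i).
Proof.
move=> hU; rewrite -(udu1 hU) !uduZ.
have -> : - udu U (fun i => e * d i) = (-1)%:C *: udu U (fun i => e * d i).
  by rewrite rmorphN rmorph1 scaleN1r.
by rewrite uduZ uduD; apply: eq_udu => i; rewrite mulr1 mulN1r.
Qed.

(* The resolvents of [(Z p - 1) / p] are squeezed between two explicit
   diagonal families; outside [b] the spectrum of [(Z p - 1) / p] goes to -oo,
   so the resolvent tends to 0 there. *)
Lemma power_cvg n (U : 'M[C]_n) (b : 'I_n -> bool) (k : 'I_n -> R) (D r : R)
    (Z : R -> 'M[C]_n) : unitarymx U -> r < 1 ->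
  (\forall p \near 0^'+, [/\ hermitian (Z p), qle 0 (Z p),
     qle (udu U (fun i => if b i then 1 + p * k i - D * p ^+ 2 else 0)) (Z p) &
     qle (Z p) (udu U (fun i => if b i then 1 + p * k i + D * p ^+ 2 else r))]) ->
  mx_cvg0r (fun p => mxpow (Z p) p^-1)
    (udu U (fun i => if b i then expR (k i) else 0)).
Proof.
move=> hU r1 hZ.
(* The point [s] exceeds every [k i] by at least 1, so the resolvents at [s] stay bounded. *)
pose s := 1 + \sum_i `|k i|.
have ks i : k i + 1 <= s.
  by rewrite addrC lerD2l; apply: le_trans (ler_norm _) (ler_sum_norm k i).
have s0 : 0 < s by rewrite ltr_pwDl // sumr_ge0.
have hWz p : exists Wz : 'M[C]_n * ('I_n -> R),
    hermitian (Z p) -> unitarymx Wz.1 /\ Z p = udu Wz.1 Wz.2.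
  have [hp|hp] := pselect (hermitian (Z p)).
    by have [W [z h]] := hermitian_spectral hp; exists (W, z).
  by exists (1%:M, fun=> 0).
have {hWz}[Wz hWz] := choice hWz.
(* These are the eigenvalues of s - (Z_p - 1) / p. The sign reverses the order: [nlo] comes from the
   upper bound on Z_p and [nhi] from the lower one. *)
pose nu p j := s - p^-1 * ((Wz p).2 j - 1).
pose nlo p i := if b i then s - k i - D * p else s + (1 - r) / p.
pose nhi p i := if b i then s - k i + D * p else s + 1 / p.
have hW : \forall p \near 0^'+, unitarymx (Wz p).1.
  by apply: filterS hZ => p [h _ _ _]; have [] := hWz p h.
have Dp : \forall p \near 0^'+, `|D * p| <= 2^-1.
  have : D * p @[p --> 0^'+] --> (0 : R) by exact: cvg_mull0.
  have h2 : 0 < (2^-1 : R) by rewrite invr_gt0.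
  move=> /cvgrPdist_le/(_ _ h2); apply: filterS => p.
  by rewrite sub0r normrN.
have nlo12 : \forall p \near 0^'+, forall i, 2^-1 <= nlo p i.
  near=> p => i; have p0 : 0 < p by near: p; exact: nbhs_right_gt.
  have : `|D * p| <= 2^-1 by near: p.
  rewrite ler_norml /nlo => /andP[h1 h2]; case: ifP => _.
    by have := ks i; lra.
  have : 0 <= (1 - r) / p by rewrite divr_ge0 // ?subr_ge0 ltW.
  have : 1 <= s by rewrite lerDl sumr_ge0.
  by lra.
have nhi12 : \forall p \near 0^'+, forall i, 2^-1 <= nhi p i.
  near=> p => i; have p0 : 0 < p by near: p; exact: nbhs_right_gt.
  have : `|D * p| <= 2^-1 by near: p.
  rewrite ler_norml /nhi => /andP[h1 h2]; case: ifP => _.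
    by have := ks i; lra.
  have : 0 <= 1 / p by rewrite divr_ge0 // ltW.
  have : 1 <= s by rewrite lerDl sumr_ge0.
  by lra.
have half0 : 0 < (2^-1 : R) by rewrite invr_gt0.
have bounds : \forall p \near 0^'+, [/\ qle (udu U (nlo p)) (udu (Wz p).1 (nu p)),
    qle (udu (Wz p).1 (nu p)) (udu U (nhi p)) & forall j, 2^-1 <= nu p j].
  near=> p; have p0 : 0 < p by near: p; exact: nbhs_right_gt.
  have [hp _ lb ub] : [/\ hermitian (Z p), qle 0 (Z p),
     qle (udu U (fun i => if b i then 1 + p * k i - D * p ^+ 2 else 0)) (Z p) &
     qle (Z p) (udu U (fun i => if b i then 1 + p * k i + D * p ^+ 2 else r))].
    by near: p.
  have q1 : forall i, 2^-1 <= nlo p i by near: p.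
  have [hWp ZE] := hWz p hp.
  have ip0 : 0 <= p^-1 by rewrite invr_ge0 ltW.
  have nuE : (s + p^-1)%:C *: 1%:M - (p^-1)%:C *: Z p = udu (Wz p).1 (nu p).
    rewrite {1}ZE (udu_affine _ _ _ hWp); apply: eq_udu => i.
    by rewrite /nu; ring.
  have h1 : qle (udu U (nlo p)) (udu (Wz p).1 (nu p)).
    rewrite -nuE; have := qle_affine (s + p^-1) ip0 ub.
    rewrite (udu_affine _ _ _ hU); apply: qle_trans; apply: qle_udu => i.
    rewrite /nlo le_eqVlt; apply/orP; left; apply/eqP.
    by case: ifP => _; field; rewrite gt_eqF.
  have h2 : qle (udu (Wz p).1 (nu p)) (udu U (nhi p)).
    rewrite -nuE; have := qle_affine (s + p^-1) ip0 lb.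
    rewrite (udu_affine _ _ _ hU) => /qle_trans; apply; apply: qle_udu => i.
    rewrite /nhi le_eqVlt; apply/orP; left; apply/eqP.
    by case: ifP => _; field; rewrite gt_eqF.
  split=> // j; apply: (udu_eigen_ge j hWp).
  apply: qle_trans h1; rewrite -(udu1 hU) uduZ; apply: qle_udu => i.
  by rewrite mulr1; exact: q1.
pose d i := if b i then (s - k i)^-1 else 0.
have sk0 i : s - k i != 0 by rewrite gt_eqF // subr_gt0; have := ks i; lra.
have res_cvg : mx_cvg0r (fun p => udu (Wz p).1 (fun j => (nu p j)^-1)) (udu U d).
  apply: (sandwich_cvg (l := fun p i => (nhi p i)^-1) (m := fun p i => (nlo p i)^-1)) => //.
  - near=> p.
    have [h1 h2 h3] : [/\ qle (udu U (nlo p)) (udu (Wz p).1 (nu p)),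
        qle (udu (Wz p).1 (nu p)) (udu U (nhi p)) & forall j, 2^-1 <= nu p j].
      by near: p.
    have hWp : unitarymx (Wz p).1 by near: p.
    have q1 : forall i, 2^-1 <= nlo p i by near: p.
    have q2 : forall i, 2^-1 <= nhi p i by near: p.
    have q1' i : 0 < nlo p i by exact: lt_le_trans (q1 i).
    have q2' i : 0 < nhi p i by exact: lt_le_trans (q2 i).
    have q3' i : 0 < nu p i by exact: lt_le_trans (h3 i).
    split; first exact: hermitian_udu.
      exact: qle_udu_inverse.
    exact: qle_udu_inverse.
  - move=> i; rewrite /nhi /d; case: ifP => _; last exact: inv_affine_cvg0.
    apply: cvgV => //; rewrite -[X in _ --> X]addr0.
    by apply: cvgD; [exact: cvg_cst|exact: cvg_mull0].
  - move=> i; rewrite /nlo /d; case: ifP => _.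
      apply: cvgV => //; rewrite -[X in _ --> X]subr0.
      by apply: cvgB; [exact: cvg_cst|exact: cvg_mull0].
    by apply: inv_affine_cvg0; rewrite subr_gt0.
have zE p j : 0 < p -> (Wz p).2 j = 1 + p * (s - nu p j).
  by move=> p0; rewrite /nu; field; rewrite gt_eqF.
have z0 : \forall p \near 0^'+, forall j, 0 <= (Wz p).2 j.
  apply: filterS hZ => p [h1 h2 _ _] j; have [hWp ZE] := hWz p h1.
  apply: (udu_eigen_ge j hWp); rewrite -ZE scale0r.
  exact: h2.
have nu12 : \forall p \near 0^'+, forall j, 2^-1 <= nu p j.
  by apply: filterS bounds => p [].
(* The convergent matrices are the resolvents; the target function varies with [p] and is bounded by
   [expR s] because z^(1/p) <= exp(s - nu). *)
have := @spectral_cvg R n U d (fun i => if b i then expR (k i) else 0) (expR s)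
  (fun p => (Wz p).1) (fun p j => (nu p j)^-1)
  (fun p j => (Wz p).2 j `^ p^-1) hU hW.
move=> /(_ _ _ res_cvg) H.
apply: (mx_cvg0r_near (g := fun p => udu (Wz p).1 (fun j => (Wz p).2 j `^ p^-1))).
  near=> p; have hp : hermitian (Z p).
    by near: p; apply: filterS hZ => p [].
  by have [hWp ->] := hWz p hp; rewrite (mxpow_udu _ _ hWp).
apply: H.
- near=> p => j; have p0 : 0 < p by near: p; exact: nbhs_right_gt.
  have zj : forall j, 0 <= (Wz p).2 j by near: p.
  have nj : forall j, 2^-1 <= nu p j by near: p.
  rewrite ger0_norm ?powR_ge0 //; apply: le_trans (powR_root_le (zj j) p0 (zE p j p0)) _.
  by rewrite ler_expR; have := nj j; lra.
- move=> i e e0; rewrite /d; case: ifP => _.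
    have [de de0 hde] := root_limit_pos (ks i) e0; exists de => //.
    near=> p => j; have p0 : 0 < p by near: p; exact: nbhs_right_gt.
    have zj : forall j, 0 <= (Wz p).2 j by near: p.
    have nj : forall j, 2^-1 <= nu p j by near: p.
    move: (zj j) (zE p j p0) (nj j); move: ((Wz p).2 j) (nu p j) => z x h1 h2 h3.
    by move: x z h1 h2 h3 {zj nj}; near: p; apply: filterS hde => p h x z; exact: h.
  have [de de0 hde] := root_limit0 s e0; exists de => //.
  near=> p => j; have p0 : 0 < p by near: p; exact: nbhs_right_gt.
  have zj : forall j, 0 <= (Wz p).2 j by near: p.
  have nj : forall j, 2^-1 <= nu p j by near: p.
  by apply: (hde p) (zj j) (zE p j p0) _ => //; exact: lt_le_trans (nj j).
Unshelve. all: by end_near. Qed.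

End PowerConvergence.

(** * Second-order bounds for powers and for block decompositions *)

Section BlockBounds.
Variable R : realType.
Local Notation C := R[i].

Lemma block_split n (P X K : 'M[C]_n) : P + X = 1%:M ->
  K = P *m K *m P + X *m K *m X + (P *m K *m X + X *m K *m P).
Proof.
move=> PX; rewrite -[LHS]mul1mx -[LHS]mulmx1 -PX mulmxDr !mulmxDl.
have add4 (a b c d : 'M[C]_n) : a + b + (c + d) = a + d + (c + b).
  by rewrite [c + d]addrC addrACA [b + c]addrC.
exact: add4.
Qed.

Lemma qle_cross n (A X : 'M[C]_n) v :
  rq (A^H *m X) v + rq (X^H *m A) v <= rq (A^H *m A) v + rq (X^H *m X) v.
Proof.
have := rq_gram_ge0 (A - X) v.
rewrite adjmxB mulmxBl [X in X - _]mulmxBr [X in _ - X]mulmxBr rqB [X in X - _]rqB [X in _ - X]rqB.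
move: (rq _ v) (rq _ v) (rq _ v) (rq _ v); clear; move=> *; lra.
Qed.

(* Young's inequality for the off-diagonal blocks of [K]: they cost [m^2 p^2
   / t^2] on the range of [P] and only [t^2] on its complement. *)
Lemma block_upper n (P K Q : 'M[C]_n) (r m t p c : R) :
  orthproj P -> hermitian K -> 0 < t -> 0 <= p ->
  qle K (m%:C *: 1%:M) -> qle (K *m K) ((m ^+ 2)%:C *: 1%:M) ->
  qle Q (P + r%:C *: (1%:M - P)) ->
  qle (Q + p%:C *: K + (c * p ^+ 2)%:C *: 1%:M)
      (p%:C *: (P *m K *m P) + (1 + (m ^+ 2 / t ^+ 2 + c) * p ^+ 2)%:C *: P +
       (r + t ^+ 2 + p * m + c * p ^+ 2)%:C *: (1%:M - P)).
Proof.
move=> [hP PP] hK t0 p0 Km KKm Qr v.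
have hX : (1%:M - P)^H = 1%:M - P by rewrite adjmxB adjmx1 hP.
have XX : (1%:M - P) *m (1%:M - P) = 1%:M - P.
  by rewrite -{1}hX; exact: orthproj_compl.
have one : rq 1%:M v = rq P v + rq (1%:M - P) v by rewrite rqB addrC subrK.
have P1 : P + (1%:M - P) = 1%:M by rewrite addrC subrK.
move: (1%:M - P) hX XX one P1 Qr => X hX XX one P1 Qr.
have KE : rq K v = rq (P *m K *m P) v + rq (X *m K *m X) v +
    (rq (P *m K *m X) v + rq (X *m K *m P) v).
  by rewrite [in LHS](block_split K P1) rqD [X in X + _]rqD [X in _ + X]rqD.
have crossE : p * (rq (P *m K *m X) v + rq (X *m K *m P) v) <=
    m ^+ 2 / t ^+ 2 * p ^+ 2 * rq P v + t ^+ 2 * rq X v.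
  have := qle_cross ((p / t)%:C *: (K *m P)) (t%:C *: X) v.
  rewrite !adjmxZ adjmxM hP hK hX.
  rewrite -!scalemxAl -!scalemxAr !scalerA -!rmorphM !rqZ !mulmxA XX.
  have -> : p / t * t = p by field; rewrite gt_eqF.
  have -> : t * (p / t) = p by field; rewrite gt_eqF.
  have : rq (P *m K *m K *m P) v <= m ^+ 2 * rq P v.
    have := qle_conj P KKm v.
    rewrite hP -scalemxAr mulmx1 -scalemxAl PP rqZ !mulmxA; exact.
  have pt0 : 0 <= p / t * (p / t) by rewrite -expr2 sqr_ge0.
  move=> /(ler_wpM2l pt0).
  have -> : m ^+ 2 / t ^+ 2 * p ^+ 2 * rq P v = p / t * (p / t) * (m ^+ 2 * rq P v).
    by field; rewrite gt_eqF.
  rewrite -[t * t]expr2.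
  move: (rq (P *m K *m X) v) (rq (X *m K *m P) v) (rq (P *m K *m K *m P) v) (rq P v) (rq X v).
  by clear; move=> *; lra.
have XKX : rq (X *m K *m X) v <= m * rq X v.
  have := qle_conj X Km v.
  by rewrite hX -scalemxAr mulmx1 -scalemxAl XX rqZ.
have QE := Qr v; rewrite rqD rqZ in QE.
rewrite [leLHS]rqD [leLHS](_ : _ = rq Q v + p * rq K v + c * p ^+ 2 * rq 1%:M v);
  last by rewrite rqD !rqZ.
rewrite [leRHS](_ : _ = p * rq (P *m K *m P) v +
   (1 + (m ^+ 2 / t ^+ 2 + c) * p ^+ 2) * rq P v +
   (r + t ^+ 2 + p * m + c * p ^+ 2) * rq X v); last by rewrite !rqD !rqZ.
rewrite one KE; have := ler_wpM2l p0 XKX; move: QE crossE.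
move: (rq (P *m K *m P) v) (rq (X *m K *m X) v) (rq P v) (rq X v) (rq Q v).
move: (rq _ v + rq _ v) (m ^+ 2 / t ^+ 2); clear; move=> *; lra.
Qed.

(** From exp(-x) >= 1 - x and (1 - x) (1 + x + 2 x^2) = 1 + x^2 (1 - 2 x) >= 1. *)
Lemma expR_ub2 (x : R) : `|x| <= 1 / 2 -> expR x <= 1 + x + 2 * x ^+ 2.
Proof.
rewrite ler_norml => /andP[x1 x2].
have y0 : 0 < 1 - x by lra.
have h : 1 - x <= (expR x)^-1 by rewrite -expRN; exact: expR_ge1Dx.
have : (1 - x) * expR x <= 1 by rewrite -ler_pdivlMr ?expR_gt0 // div1r.
have : 1 <= (1 - x) * (1 + x + 2 * x ^+ 2) by have := sqr_ge0 x; nra.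
by move=> h1 h2; rewrite -(ler_pM2l y0); apply: le_trans h2 h1.
Qed.

(** Both parts are [expR_ub2] at p ln a and - p ln a; where [a i = 0], power and inverse are 0 and
    only the nonnegative error term remains. The pseudo-inverse needs an upper bound because it
    enters the harmonic bound with a minus sign. *)
Lemma qle_power_ub n (U : 'M[C]_n) (a : 'I_n -> R) (M p : R) : unitarymx U ->
  (forall i, 0 <= a i) -> (forall i, `|ln (a i)| <= M) -> 0 < p -> p * M <= 1 / 2 ->
  qle (udu U (fun i => a i `^ p))
      (udu U (fun i => (a i != 0)%:R) +
       p%:C *: udu U (fun i => if a i == 0 then 0 else ln (a i)) +
       (2 * M ^+ 2 * p ^+ 2)%:C *: 1%:M) /\
  qle (udu U (fun i => (a i `^ p)^-1))
      (udu U (fun i => (a i != 0)%:R) +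
       (- p)%:C *: udu U (fun i => if a i == 0 then 0 else ln (a i)) +
       (2 * M ^+ 2 * p ^+ 2)%:C *: 1%:M).
Proof.
move=> hU a0 aM p0 pM; rewrite -(udu1 hU) !uduZ !uduD.
have c0 : 0 <= 2 * M ^+ 2 * p ^+ 2 by apply: mulr_ge0; [apply: mulr_ge0 => //|]; exact: sqr_ge0.
have key i x : `|x| = p * `|ln (a i)| -> expR x <= 1 + x + 2 * M ^+ 2 * p ^+ 2.
  move=> xE; have pl : p * `|ln (a i)| <= p * M by rewrite ler_pM2l.
  have := @expR_ub2 x; rewrite xE => /(_ (le_trans pl pM)) /le_trans; apply.
  rewrite lerD2l -real_normK ?num_real // xE -mulrA ler_pM2l // exprMn mulrC.
  rewrite ler_wpM2r ?sqr_ge0 // ler_pXn2r ?nnegrE //.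
  exact: le_trans (aM i).
split; apply: qle_udu => i; have [ai|ai] := eqVneq (a i) 0.
- by rewrite ai powR0 ?gt_eqF // mulr0 !add0r mulr1.
- rewrite /powR (negbTE ai) mulr1; apply: key.
  by rewrite normrM gtr0_norm.
- by rewrite ai powR0 ?gt_eqF // invr0 mulr0 !add0r mulr1.
- rewrite /powR (negbTE ai) mulr1 -expRN mulNr; apply: key.
  by rewrite normrN normrM gtr0_norm.
Qed.

Lemma qle_comb n (c d : R) (X Y X' Y' : 'M[C]_n) : 0 <= c -> 0 <= d ->
  qle X X' -> qle Y Y' -> qle (c%:C *: X + d%:C *: Y) (c%:C *: X' + d%:C *: Y').
Proof.
move=> c0 d0 hX hY v; rewrite [leLHS]rqD [leRHS]rqD.
by apply: lerD; rewrite [leLHS]rqZ [leRHS]rqZ; apply: ler_wpM2l.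
Qed.

Lemma convex_comb_expand (V : lmodType C) (al p c : R) (S S' L L' I : V) :
  (1 - al)%:C *: (S + p%:C *: L + c%:C *: I) +
  al%:C *: (S' + p%:C *: L' + c%:C *: I) =
  ((1 - al)%:C *: S + al%:C *: S') + p%:C *: ((1 - al)%:C *: L + al%:C *: L') +
  c%:C *: I.
Proof.
rewrite !scalerDr addrACA [X in X + _]addrACA -scalerDl -rmorphD subrK rmorph1.
by rewrite scale1r !scalerA ![_ * p%:C]mulrC.
Qed.

Lemma max_lt1 n (q : 'I_n -> R) : (forall i, q i <= 1) ->
  exists2 r : R, 0 <= r /\ r < 1 & forall i, q i != 1 -> q i <= r.
Proof.
(* The base value 0 covers the case where all [q i] equal 1 and ensures [0 <= r]. *)
move=> q1; exists (\big[Num.max/0]_(i | q i != 1) q i).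
  split; first exact: bigmax_ge_id.
  apply: bigmax_lt => // i qi; rewrite lt_neqAle qi q1.
  exact: isT.
by move=> i qi; apply: le_bigmax_cond.
Qed.

End BlockBounds.

(** * The bounds for Z_p put together *)

Section Assembly.
Variable R : realType.
Local Notation C := R[i].

Lemma udu_compl n (U : 'M[C]_n) d : unitarymx U ->
  1%:M - udu U d = udu U (fun i => 1 - d i).
Proof.
move=> hU; have := udu_affine 1 1 d hU; rewrite rmorph1 !scale1r => ->.
by apply: eq_udu => i; rewrite mul1r.
Qed.

Lemma hermitian_bound n (K : 'M[C]_n) : hermitian K ->
  exists m : R, qle K (m%:C *: 1%:M) /\ qle (K *m K) ((m ^+ 2)%:C *: 1%:M).
Proof.
move=> /hermitian_spectral[U [k [hU ->]]]; exists (\sum_i `|k i|).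
rewrite (uduM _ _ hU) -(udu1 hU) !uduZ; split; apply: qle_udu => i.
  by rewrite mulr1; apply: le_trans (ler_norm _) (ler_sum_norm k i).
rewrite mulr1 -expr2 -real_normK ?num_real // ler_pXn2r ?nnegrE ?sumr_ge0 //.
exact: ler_sum_norm.
Qed.

Lemma psdmx_udu n (U : 'M[C]_n) (d : 'I_n -> R) : (forall i, 0 <= d i) ->
  psdmx (udu U d).
Proof.
move=> d0; apply: qle_psd; first exact: hermitian_udu.
by rewrite -(udu0 U); exact: qle_udu.
Qed.

Lemma neg_comb (V : lmodType C) (p c : R) (P Q K I : V) :
  P + P - (Q + (- p)%:C *: K + c%:C *: I) =
  P + P - Q + p%:C *: K - c%:C *: I.
Proof. by rewrite !opprD rmorphN scaleNr opprK !addrA. Qed.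

Lemma conj_expand n (P Q K : 'M[C]_n) (p d : R) : P *m P = P ->
  P *m (Q + p%:C *: K + d%:C *: 1%:M) *m P =
  P *m Q *m P + p%:C *: (P *m K *m P) + d%:C *: P.
Proof.
move=> PP; rewrite !mulmxDr !mulmxDl -!scalemxAr -!scalemxAl mulmx1 PP.
exact: erefl.
Qed.

Lemma qle_conj_expand n (P Q K X : 'M[C]_n) (p d : R) : orthproj P ->
  P *m Q *m P = P -> qle X (Q + p%:C *: K + d%:C *: 1%:M) ->
  qle (P *m X *m P) (P + p%:C *: (P *m K *m P) + d%:C *: P).
Proof.
move=> [hP PP] PQP /(@qle_conj _ _ _ _ _ P).
by rewrite hP (conj_expand _ _ _ _ PP) PQP.
Qed.

Lemma qle_subl n (M X Y : 'M[C]_n) : qle X Y -> qle (M - Y) (M - X).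
Proof. by move=> h v; rewrite [leLHS]rqB [leRHS]rqB lerD2l lerN2; exact: h. Qed.

End Assembly.

Theorem theoremA1 (R : realType) (f : R -> R) (alpha : R)
  (hf : KA_function f) (hder : is_derive (1 : R) 1 f alpha)
  (ha0 : 0 < alpha) (ha1 : alpha < 1)
  (n : nat) (A B : 'M[R[i]]_n) (hA : psdmx A) (hB : psdmx B) :
  let P0 := projmeet (suppmx A) (suppmx B) in
  mx_cvg0r (fun p : R => mxpow (KA_mean f (mxpow A p) (mxpow B p)) p^-1)
    (P0 *m mxexp (((1 - alpha)%:C)%:M *m (P0 *m mxlog A *m P0)
                  + (alpha%:C)%:M *m (P0 *m mxlog B *m P0))).
Proof.
move=> P0.
have [UA [a [hUA a0 EA]]] := psd_spectral hA.
have [UB [b [hUB b0 EB]]] := psd_spectral hB.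
pose lg (x : R) := if x == 0 then 0 else ln x.
pose SA := udu UA (fun i => (a i != 0)%:R); pose LA := udu UA (fun i => lg (a i)).
pose SB := udu UB (fun i => (b i != 0)%:R); pose LB := udu UB (fun i => lg (b i)).
have logA : mxlog A = LA by rewrite /mxlog EA (mxfun_udu _ _ hUA).
have logB : mxlog B = LB by rewrite /mxlog EB (mxfun_udu _ _ hUB).
have hSA : orthproj SA by exact: (orthproj_udu (fun i => a i != 0) hUA).
have hSB : orthproj SB by exact: (orthproj_udu (fun i => b i != 0) hUB).
pose K := (1 - alpha)%:C *: LA + alpha%:C *: LB.
pose Q := (1 - alpha)%:C *: SA + alpha%:C *: SB.
have hK : hermitian K.
  by apply: hermitianD; apply: hermitianZ; exact: hermitian_udu.
have hQ : hermitian Q.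
  by apply: hermitianD; apply: hermitianZ; exact: hermitian_udu.
have [W [q [hW QE]]] := hermitian_spectral hQ.
have P0E : P0 = udu W (fun i => (q i == 1)%:R).
  rewrite /P0 EA EB (suppmx_udu _ hUA) (suppmx_udu _ hUB).
  exact: (projmeet_udu hSA hSB ha0 ha1 hW QE).
have hP0 : orthproj P0 by rewrite P0E; exact: (orthproj_udu (fun i => q i == 1) hW).
have [hP P0P0] := hP0.
have [SAP SBP] := convex_proj_fixed hSA hSB ha0 ha1 hW QE.
rewrite -P0E in SAP SBP.
have PSA : P0 *m SA = P0.
  have := congr1 (@adjmx R n n) SAP; rewrite adjmxM hP (hermitian_udu UA).
  exact.
have PSB : P0 *m SB = P0.
  have := congr1 (@adjmx R n n) SBP; rewrite adjmxM hP (hermitian_udu UB).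
  exact.
have PQP : P0 *m Q *m P0 = P0.
  rewrite /Q mulmx_comb PSA PSB P0P0 -scalerDl -rmorphD subrK rmorph1 scale1r.
  exact: erefl.
pose K' := P0 *m K *m P0.
have hK' : hermitian K' by rewrite /K' -{1}hP; exact: hermitian_conj.
have PK' : P0 *m K' = K' by rewrite /K' !mulmxA P0P0.
have K'P : K' *m P0 = K' by rewrite /K' -mulmxA P0P0.
have [U [s [k [hU PU KU k0]]]] := proj_simultaneous hP0 hK' PK' K'P.
(* Off P0 the exponent is 0 and its exponential 1; the outer factor [P0] turns this 1 into 0. *)
have -> : P0 *m mxexp (((1 - alpha)%:C)%:M *m (P0 *m mxlog A *m P0)
                  + (alpha%:C)%:M *m (P0 *m mxlog B *m P0)) =
    udu U (fun i => if s i then expR (k i) else 0).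
  rewrite logA logB !mul_scalar_mx -mulmx_comb -/K -/K' KU /mxexp.
  rewrite (mxfun_udu _ _ hU) PU (uduM _ _ hU); apply: eq_udu => i.
  by case: (s i); rewrite ?mul1r ?mul0r.
have [m [Km KKm]] := hermitian_bound hK.
have q1 := convex_proj_eigen_le1 hSA hSB ha0 ha1 hW QE.
have [r [r0 r1] hr] := max_lt1 q1.
have Qr : qle Q (P0 + r%:C *: (1%:M - P0)).
  rewrite QE P0E (udu_compl _ hW) uduZ uduD; apply: qle_udu => i.
  have [->|qi] := eqVneq (q i) 1; first by rewrite subrr mulr0 addr0.
  by rewrite subr0 mulr1 add0r; exact: hr.
(* Off P0 the upper bound is r + t^2 + p m + c p^2. With t^2 <= t and p m + c p^2 <= t for small
   [p], it is at most r + 2 t = (1 + r) / 2 < 1. *)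
pose t := (1 - r) / 4.
have t0 : 0 < t by rewrite divr_gt0 // subr_gt0.
have tt : t ^+ 2 <= t.
  by rewrite expr2 -[leRHS]mulr1 ler_pM2l // /t; lra.
pose M := \sum_i `|ln (a i)| + \sum_i `|ln (b i)|.
have aM i : `|ln (a i)| <= M.
  by apply: le_trans (ler_sum_norm (fun i => ln (a i)) i) _; rewrite lerDl sumr_ge0.
have bM i : `|ln (b i)| <= M.
  by apply: le_trans (ler_sum_norm (fun i => ln (b i)) i) _; rewrite lerDr sumr_ge0.
pose c := 2 * M ^+ 2.
have c0 : 0 <= c by rewrite mulr_ge0 ?sqr_ge0.
(* The upper bound costs m^2 / t^2 from Young's inequality and [c] from the exponential; the lower
   bound costs only [c], so [D] serves both. *)
pose D := m ^+ 2 / t ^+ 2 + c.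
have cD : c <= D by rewrite /D lerDr divr_ge0 ?sqr_ge0.
have pM : \forall p \near 0^'+, p * M <= 1 / 2.
  have h2 : 0 < (1 / 2 : R) by rewrite divr_gt0.
  have /cvgrPdist_le/(_ _ h2) := @cvg_mull0 R M; apply: filterS => p.
  by rewrite sub0r normrN mulrC; apply: le_trans; exact: ler_norm.
have pt : \forall p \near 0^'+, p * m + c * p ^+ 2 <= t.
  have H : m * p + c * p * p @[p --> 0^'+] --> (0 : R).
    rewrite -[X in _ --> X](addr0 0); apply: cvgD; first exact: cvg_mull0.
    rewrite -[X in _ --> X](mulr0 0); apply: cvgM; first exact: cvg_mull0.
    exact: at_right_id.
  have /cvgrPdist_le/(_ _ t0) := H; apply: filterS => p.
  rewrite sub0r normrN; apply: le_trans; apply: le_trans (ler_norm _).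
  by rewrite [p * m]mulrC expr2 mulrA.
have al1 : 0 <= 1 - alpha by rewrite subr_ge0 ltW.
apply: (power_cvg (D := D) (r := r + 2 * t)) => //; first by rewrite /t; lra.
near=> p; have p0 : 0 < p by near: p; exact: nbhs_right_gt.
have pM' : p * M <= 1 / 2 by near: p.
have pt' : p * m + c * p ^+ 2 <= t by near: p.
have ApE : mxpow A p = udu UA (fun i => a i `^ p) by rewrite EA (mxpow_udu _ _ hUA).
have BpE : mxpow B p = udu UB (fun i => b i `^ p) by rewrite EB (mxpow_udu _ _ hUB).
have ap0 i : 0 <= a i `^ p by exact: powR_ge0.
have bp0 i : 0 <= b i `^ p by exact: powR_ge0.
have hAp : psdmx (mxpow A p) by rewrite ApE; exact: psdmx_udu.
have hBp : psdmx (mxpow B p) by rewrite BpE; exact: psdmx_udu.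
have [ubA lbA] := qle_power_ub hUA a0 aM p0 pM'.
have [ubB lbB] := qle_power_ub hUB b0 bM p0 pM'.
(* Taken with [e = p] for the arithmetic bound and with [e = - p] for the harmonic one. *)
have expand e : (1 - alpha)%:C *: (SA + e%:C *: LA + (c * p ^+ 2)%:C *: 1%:M) +
    alpha%:C *: (SB + e%:C *: LB + (c * p ^+ 2)%:C *: 1%:M) =
    Q + e%:C *: K + (c * p ^+ 2)%:C *: 1%:M by exact: convex_comb_expand.
split.
- exact: (KA_mean_hermitian hf hder ha0 ha1 hAp hBp).
- exact: (KA_mean_ge0 hf hder ha0 ha1 hAp hBp).
(* [A^p] and [A] have the same support, so [P0] also lies below the supports of the powers. The
   bound becomes 2 P0 - (P0 - p K' + c p^2 P0) = P0 + p K' - c p^2 P0. *)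
- have suppP (V : 'M[R[i]]_n) (d : 'I_n -> R) :
      P0 *m udu V (fun i => (d i != 0)%:R) = P0 ->
      P0 *m udu V (fun i => (d i `^ p != 0)%:R) = P0.
    have -> : (fun i => (d i `^ p != 0)%:R) = (fun i => (d i != 0)%:R) :> ('I_n -> R).
      by apply/funext => i; rewrite powR_eq0 (gt_eqF p0) andbT.
    exact.
  have := KA_mean_ge_harm hf hder ha0 ha1 hAp hBp hP hUA hUB ap0 bp0 ApE BpE
    (suppP _ _ PSA) (suppP _ _ PSB).
  apply: qle_trans.
  have lb := qle_comb al1 (ltW ha0) lbA lbB.
  rewrite expand in lb.
  have {}lb : qle _ (P0 + (- p)%:C *: K' + (c * p ^+ 2)%:C *: P0) :=
    qle_conj_expand hP0 PQP lb.
  apply: qle_trans (qle_subl (P0 + P0) lb).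
  rewrite neg_comb addrK KU PU.
  have -> : forall Z : 'M[R[i]]_n, - ((c * p ^+ 2)%:C *: Z) = (- (c * p ^+ 2))%:C *: Z.
    by move=> Z; rewrite rmorphN scaleNr.
  rewrite !uduZ !uduD; apply: qle_udu => i.
  have [si|si] := boolP (s i); last by rewrite (k0 i si) !mulr0 !addr0.
  by rewrite mulr1 lerD2l lerN2 ler_wpM2r ?sqr_ge0.
- apply: qle_trans (KA_mean_le_arith hf hder ha0 ha1 hAp hBp) _.
  rewrite ApE BpE; apply: qle_trans (qle_comb al1 (ltW ha0) ubA ubB) _.
  rewrite expand; apply: qle_trans (block_upper c hP0 hK t0 (ltW p0) Km KKm Qr) _.
  rewrite -/K' -/D KU PU (udu_compl _ hU) !uduZ !uduD; apply: qle_udu => i.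
  have [si|si] := boolP (s i); first by rewrite subrr mulr0 addr0 mulr1; lra.
  by rewrite (k0 i si) !mulr0 !add0r subr0 mulr1; lra.
Unshelve. all: by end_near. Qed.
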